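(* Suppose that there exist a continuous function $w\ge 1$ on $S$, constants $\rho, b\ge 0$, and a nondecreasing sequence $\{S_k\}$ of subsets of $S$ such that: $\int_S w(y)\,q(dy|x,a)\le \rho w(x)+b$ for all $(x,a)\in K$; $\inf_{x\notin S_k} w(x)\uparrow +\infty$ as $k\to\infty$ (with $\inf\varnothing:=\infty$); $S_k\uparrow S$ and $\sup_{a\in A(x),\,x\in S_k}|q(\{x\}|x,a)|<\infty$ for all $k\ge 1$. Suppose moreover that: there exists a constant $M>0$ such that $|c_n(x,a)|\le Mw(x)$ for every $(x,a)\in K$ and $n=0,1,\ldots,N$; the discount factor satisfies $\alpha>\rho$; and $\int_S w(x)\gamma(dx)<\infty$. Then, for each policy $\pi\in\Pi$ and $x\in S$: (a) $E^\pi_x\big[\int_A|c_n(\xi_t,a)|\,\pi(da|e,t)\big]\le M\,E^\pi_x[w(\xi_t)]$ for all $t\ge0$ and $n=0,1,\ldots,N$; (b) $|V_n(x,\pi)|\le \dfrac{M[\alpha w(x)+b]}{\alpha(\alpha-\rho)}$ and $|V_n(\pi)|\le M M_1^*$ for $n=0,1,\ldots,N$, where $M_1^*:=\dfrac{\alpha\int_S w(x)\gamma(dx)+b}{\alpha(\alpha-\rho)}$.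
   Context: Model. $S$ (states) and $A$ (actions) are Polish spaces with Borel $\sigma$-algebras $\mathcal B(S),\mathcal B(A)$; for each $x\in S$, $A(x)\subseteq A$ is a Borel set of admissible actions; $K:=\{(x,a): x\in S, a\in A(x)\}$ is a Borel subset of $S\times A$. The transition rates $q(\cdot|x,a)$, $(x,a)\in K$, satisfy: for fixed $(x,a)$, $q(\cdot|x,a)$ is a signed measure on $\mathcal B(S)$, and for fixed $D\in\mathcal B(S)$, $q(D|\cdot)$ is real-valued and Borel measurable on $K$; $0\le q(D|x,a)<\infty$ whenever $x\notin D\in\mathcal B(S)$; $q(S|x,a)=0$; and $q^*(x):=\sup_{a\in A(x)}|q(\{x\}|x,a)|<\infty$ for all $x\in S$. The reward $r$ and costs $c_1,\ldots,c_N$ are real-valued measurable functions on $K$; $c_0:=-r$. A discount factor $\alpha>0$ and a probability measure $\gamma$ on $S$ (initial distribution) are fixed. State process. Adjoin isolated points: $S_\infty:=S\cup\{x_\infty\}$, $A_\infty:=A\cup\{a_\infty\}$, $A(x_\infty):=\{a_\infty\}$, $q(\cdot|x_\infty,a_\infty)\equiv 0$. $\mathbb R_+:=(0,\infty)$, $\mathbb R_+^0:=[0,\infty)$. $\Omega$ consists of all sequences $e=(x_0,\theta_1,x_1,\theta_2,x_2,\ldots)$ in $(S\times\mathbb R_+)^\infty$ together with all sequences $(x_0,\theta_1,x_1,\ldots,\theta_{k-1},x_{k-1},\infty,x_\infty,\infty,x_\infty,\ldots)$, $k\ge1$, $x_l\in S$, $\theta_l\in\mathbb R_+$; $\mathcal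 F$ is the natural (product) $\sigma$-algebra. Put $T_0:=0$, $T_k:=\theta_1+\cdots+\theta_k$, $T_\infty:=\lim_k T_k$, $X_k:=x_k$, $\Theta_k:=\theta_k$, $h_k:=(x_0,\theta_1,x_1,\ldots,\theta_k,x_k)$; $\xi_t:=x_k$ if $T_k\le t<T_{k+1}$ and $\xi_t:=x_\infty$ if $t\ge T_\infty$; $\xi_{t-}$ is the left limit ($\xi_{t-}=x_k$ for $T_k<t\le T_{k+1}$, $\xi_{0-}:=x_0$, $\xi_{t-}=x_\infty$ after absorption). Let $\mu^*(dt,dx):=\sum_{k\ge0}I_{\{T_k<\infty\}}\delta_{(T_k,X_k)}(dt,dx)$, $\mathcal F_t:=\sigma\{\mu^*([0,s]\times D): s\in[0,t], D\in\mathcal B(S)\}$, $\mathcal F_{s-}:=\bigvee_{t<s}\mathcal F_t$; the predictable $\sigma$-algebra on $\Omega\times\mathbb R_+^0$ is generated by the sets $B\times\{0\}$ ($B\in\mathcal F_0$) and $C\times(s,\infty)$ ($C\in\mathcal F_{s-}$, $s>0$). Policies. A policy is a transition probability $\pi(da|e,t)$ from $\Omega\times\mathbb R_+^0$ with the predictable $\sigma$-algebra to $(A_\infty,\mathcal B(A_\infty))$ such that $\pi(A(\xi_{t-}(e))|e,t)\equiv1$. $\Pi$ is the set of all policies. Probability measure. For $\pi\in\Pi$ and a probability measure $\gamma$ on $S$, the predictable intensity $m(D|e,t):=\int_A\pi(da|e,t)\,q(D\setminus\{\xi_{t-}(e)\}|\xi_{t-}(e),a)$ has a representation $m(D|e,t)=m_k(D|h_k(e),t-T_k)$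 on $\{T_k<t\le T_{k+1}\}$. $P^\pi_\gamma$ is the unique probability measure on $(\Omega,\mathcal F)$ such that $x_0$ has law $\gamma$ and, given $h_k$ with $x_k\in S$, $P^\pi_\gamma(\Theta_{k+1}\in dt,X_{k+1}\in dx|h_k)=m_k(dx|h_k,t)e^{-\int_0^t m_k(S|h_k,v)dv}dt$ and $P^\pi_\gamma(\Theta_{k+1}=\infty,X_{k+1}=x_\infty|h_k)=e^{-\int_0^\infty m_k(S|h_k,v)dv}$. $E^\pi_\gamma$ is its expectation; $P^\pi_x,E^\pi_x$ denote the case $\gamma=\delta_x$. Criteria. For measurable $u$ on $K$, $V_\alpha(x,\pi,u):=\int_0^\infty e^{-\alpha t}E^\pi_x\big[\int_A u(\xi_{t-},a)\pi(da|e,t)\big]dt$ and $V_\alpha(\pi,u):=\int_S V_\alpha(x,\pi,u)\gamma(dx)$. $V_n(x,\pi):=V_\alpha(x,\pi,c_n)$ and $V_n(\pi):=V_\alpha(\pi,c_n)$ for $n=0,1,\ldots,N$. *)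

(* Defs.v *)
From HB Require Import structures.
From mathcomp Require Import all_boot all_order all_algebra.
From mathcomp Require Import interval_inference.
From mathcomp Require Import all_classical all_reals all_analysis.
From mathcomp Require Import measurable_realfun.

Set Implicit Arguments.
Unset Strict Implicit.
Unset Printing Implicit Defensive.

Import Order.TTheory GRing.Theory Num.Theory.
Import numFieldNormedType.Exports.

Local Open Scope classical_set_scope.
Local Open Scope ring_scope.
Local Open Scope ereal_scope.

(* A complete [ball]-structure compatible with the topology is part of the type;
   the statement uses only the topology (through [borel] and [continuous]). *)
Definition polish (R : realType) (T : completePseudoMetricType R) : Prop :=
  hausdorff_space T /\ exists2 D : set T, countable D & dense D.

Notation borel T := (g_sigma_algebraType (@open T)).

(* [option T] is T with one isolated point [None] adjoined: a set is measurable
   iff its trace on T is. *)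
Section option_measurable.
Context d (T : measurableType d).

Definition option_display : measure_display -> measure_display.
Proof. exact. Qed.

Definition option_measurable : set (set (option T)) :=
  [set B | measurable (Some @^-1` B)].

Let option_measurable0 : option_measurable set0.
Proof. by rewrite /option_measurable /= preimage_set0. Qed.

Let option_measurableC B : option_measurable B -> option_measurable (~` B).
Proof. by rewrite /option_measurable /= preimage_setC; exact: measurableC. Qed.

Let option_measurable_bigcup (F : (set (option T))^nat) :
  (forall i, option_measurable (F i)) -> option_measurable (\bigcup_i F i).
Proof.
move=> mF; rewrite /option_measurable /= preimage_bigcup.
by apply: bigcup_measurable => i _; exact: mF.
Qed.

HB.instance Definition _ := @isMeasurable.Build (option_display d) (option T)
  option_measurable option_measurable0 option_measurableC
  option_measurable_bigcup.
End option_measurable.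

Definition time (R : realType) := {nonneg R}.
HB.instance Definition _ (R : realType) := Choice.on (time R).
HB.instance Definition _ (R : realType) := isPointed.Build (time R) (0%:nng)%R.

(* The nonnegative real [t] as an element of [time R]; only used for [0 <= t]. *)
Definition to_time (R : realType) (t : R) : time R := (`|t|%:nng)%R.

Section paths.
Context d (S : measurableType d) (R : realType).

(* [path_state k] is x_k, with [None] for x_infty, and [path_sojourn k] is
   theta_(k+1). *)
Record path := Path {
  path_state : nat -> option S ;
  path_sojourn : nat -> \bar R ;
  pathP :
    (forall k, path_state k <> None /\ 0 < path_sojourn k < +oo) \/
    (exists k, [/\ forall l, (l <= k)%N -> path_state l <> None,
                   forall l, (l < k)%N -> 0 < path_sojourn l < +oo,
                   forall l, (k < l)%N -> path_state l = None &
                   forall l, (k <= l)%N -> path_sojourn l = +oo]) }.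

Let absorbed_pathP :
  let x k := if k is 0%N then Some (point : S) else None in
  let theta := fun _ : nat => +oo : \bar R in
  (forall k, x k <> None /\ 0 < theta k < +oo) \/
  (exists k, [/\ forall l, (l <= k)%N -> x l <> None,
                 forall l, (l < k)%N -> 0 < theta l < +oo,
                 forall l, (k < l)%N -> x l = None &
                 forall l, (k <= l)%N -> theta l = +oo]).
Proof. by right; exists 0%N; split=> // -[]. Qed.

HB.instance Definition _ := gen_eqMixin path.
HB.instance Definition _ := gen_choiceMixin path.
HB.instance Definition _ := isPointed.Build path (Path absorbed_pathP).

Definition coordinate_sets : set (set path) :=
  [set C | exists k (B : set (option S)),
     measurable B /\ C = path_state^~ k @^-1` B] `|`
  [set C | exists k (B : set (\bar R)),
     measurable B /\ C = path_sojourn^~ k @^-1` B].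

Definition Omega := g_sigma_algebraType coordinate_sets.

Definition jump_time (e : path) (k : nat) : \bar R :=
  \sum_(i < k) path_sojourn e i.

(* [xi e t] is x_k if T_k <= t < T_(k+1); when there is no such k, i.e. for
   t >= T_infty, it is x_infty. *)
Definition xi (e : path) (t : R) : option S :=
  xget None [set x | exists2 k,
    jump_time e k <= t%:E < jump_time e k.+1 & x = path_state e k].

(* The left limit; x_infty when [t] lies in no interval ]T_k, T_(k+1)]. *)
Definition xi_left (e : path) (t : R) : option S :=
  if (t == 0)%R then path_state e 0 else
  xget None [set x | exists2 k,
    jump_time e k < t%:E <= jump_time e k.+1 & x = path_state e k].

Definition jump_measure (e : path) (B : set (\bar R * option S)) : \bar R :=
  \sum_(0 <= k <oo | jump_time e k < +oo)
    \d_(jump_time e k, path_state e k) B.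

Definition past (t : R) : set (set path) :=
  <<s [set C | exists s (D : set S) (B : set (\bar R)),
        [/\ (0 <= s <= t)%R, measurable D, measurable B &
         C = (fun e => jump_measure e
                [set z | 0 <= z.1 <= s%:E /\ (Some @` D) z.2]) @^-1` B]] >>.

Definition strict_past (s : R) : set (set path) :=
  <<s \bigcup_(t in [set t : R | (0 <= t < s)%R]) past t >>.

Definition predictable_rectangles : set (set (path * time R)) :=
  [set B `*` [set to_time 0] | B in past 0] `|`
  [set Z | exists C (s : R), [/\ (0 < s)%R, strict_past s C &
     Z = C `*` [set t : time R | (s < t%:num)%R]]].

Definition predictable := g_sigma_algebraType predictable_rectangles.

(* (x_0, theta_1, x_1, ... , theta_k, x_k), states and sojourn times separated. *)
Definition history (k : nat) := (k.+1.-tuple (option S) * k.-tuple (\bar R))%type.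

Definition hist (k : nat) (e : path) : history k :=
  ([tuple path_state e i | i < k.+1], [tuple path_sojourn e i | i < k]).

End paths.

Arguments Omega {d} S R.
Arguments predictable {d} S R.

(* The integral with respect to a signed measure, through its Jordan
   decomposition (which does not depend on the Hahn decomposition chosen). *)
Definition charge_integral d (T : measurableType d) (R : realType)
    (nu : {charge set T -> \bar R}) (f : T -> \bar R) : \bar R :=
  let nuPN := projT2 (cid (projT2 (cid (Hahn_decomposition nu)))) in
  \int[jordan_pos nuPN]_x f x - \int[jordan_neg nuPN]_x f x.

(* Convention: functions of the state are extended by 0 to x_infty. *)
Definition at_state (S : Type) (R : realType) (x : option S)
  (u : S -> \bar R) : \bar R := oapp u 0 x.

(* The domain is A = A_infty \ {a_infty}. *)
Definition action_integral d (A : measurableType d) (R : realType)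
    (mu : {measure set (option A) -> \bar R}) (u : A -> \bar R) : \bar R :=
  \int[mu]_(a in range Some) oapp u 0 a.

Section model.
Context dS (S : measurableType dS) dA (A : measurableType dA) (R : realType).
(* The rates, the reward and the costs are total functions whose values off the
   graph of [adm] are arbitrary. *)
Variables (adm : S -> set A) (q : S -> A -> {charge set S -> \bar R}).

Definition adm_graph : set (S * A) := [set z | adm z.1 z.2].

Definition transition_rates : Prop :=
  [/\ forall D, measurable D ->
        measurable_fun adm_graph (fun z : S * A => q z.1 z.2 D),
      forall x a D, adm x a -> measurable D -> ~ D x -> 0 <= q x a D,
      forall x a, adm x a -> q x a setT = 0 &
      forall x, ereal_sup [set `|q x a [set x]| | a in adm x] < +oo].

Definition ext_adm (x : option S) : set (option A) :=
  if x is Some y then Some @` adm y else [set None].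

Definition policy (pi : R.-pker (predictable S R) ~> (option A)) : Prop :=
  forall (e : Omega S R) (t : time R), pi (e, t) (ext_adm (xi_left e t%:num)) = 1.

Variable pi : R.-pker (predictable S R) ~> (option A).

Definition intensity (e : Omega S R) (t : R) (D : set S) : \bar R :=
  at_state (xi_left e t) (fun x =>
    action_integral (pi (e, to_time t)) (fun a => q x a (D `\ x))).

Definition intensity_representation
    (m : forall k, history S R k -> R -> set S -> \bar R) : Prop :=
  forall k (e : Omega S R) (t : R) (D : set S), measurable D ->
    jump_time e k < t%:E <= jump_time e k.+1 ->
    intensity e t D = m k (hist k e) (t - fine (jump_time e k))%R D.

(* The defining property of P^pi_gamma: x_0 has law gamma and, for each k, the
   conditional law of (Theta_(k+1), X_(k+1)) given h_k on {x_k in S} is the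
   prescribed one, in the form integrated over the events {h_k in H, x_k in S}. *)
Definition strategic_measure (gamma : {measure set S -> \bar R})
    (P : probability (Omega S R) R) : Prop :=
  (forall D : set S, measurable D ->
     P [set e | (Some @` D) (path_state e 0)] = gamma D) /\
  exists2 m : forall k, history S R k -> R -> set S -> \bar R,
    intensity_representation m &
    forall k (H : set (history S R k)), measurable H ->
      let E := [set e : Omega S R | H (hist k e) /\ path_state e k <> None] in
      (forall (G : set R) (D : set S),
         measurable G -> G `<=` [set t : R | (0 < t)%R] -> measurable D ->
         P (E `&` [set e | (EFin @` G) (path_sojourn e k) /\
                           (Some @` D) (path_state e k.+1)]) =
         \int[P]_(e in E) \int[lebesgue_measure]_(t in G)
           (m k (hist k e) t D *
            expeR (- \int[lebesgue_measure]_(v in `]0%R, t])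
                       m k (hist k e) v setT))) /\
      P (E `&` [set e | path_sojourn e k = +oo /\ path_state e k.+1 = None]) =
      \int[P]_(e in E)
        expeR (- \int[lebesgue_measure]_(v in `]0%R, +oo[)
                   m k (hist k e) v setT).

Variable P : S -> probability (Omega S R) R.
Variable alpha : R.

(* [P x] plays the role of P^pi_x. *)
Definition discounted_value (u : S -> A -> R) (x : S) : \bar R :=
  \int[lebesgue_measure]_(t in `[0%R, +oo[)
    ((expR (- alpha * t))%:E *
     \int[P x]_e at_state (xi_left e t) (fun y =>
       action_integral (pi (e, to_time t)) (fun a => (u y a)%:E))).

Definition mean_discounted_value (gamma : {measure set S -> \bar R})
    (u : S -> A -> R) : \bar R :=
  \int[gamma]_x discounted_value u x.

End model.

(* c_0 = - r, and c_n = c (n - 1) for n >= 1. *)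
Definition cost (S A : Type) (R : realType) (N : nat) (r : S -> A -> R)
    (c : 'I_N -> S -> A -> R) (n : 'I_N.+1) : S -> A -> R :=
  if unlift ord0 n is Some i then c i else fun x a => (- r x a)%R.

(* Main.v *)
Require Import Defs.
From HB Require Import structures.
From mathcomp Require Import all_boot all_order all_algebra.
From mathcomp Require Import finmap interval_inference.
From mathcomp Require Import all_classical all_reals all_analysis.
From mathcomp Require Import measurable_realfun.
From mathcomp Require Import ring lra.

Import Order.TTheory GRing.Theory Num.Theory.
Import numFieldNormedType.Exports.

Set Implicit Arguments.
Unset Strict Implicit.
Unset Printing Implicit Defensive.

Local Open Scope classical_set_scope.
Local Open Scope ring_scope.
Local Open Scope ereal_scope.

(** The discounted bounds (b) rest on a drift inequality between consecutive
    jumps, summed over all jumps; (a) is pointwise along almost every path.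

    Fix x, write E for the expectation, T_k and X_k for the jump times and
    states, and let d_k = exp(- alpha T_k), which is 0 when T_k is infinite.
    Given the history up to T_k, with X_k = y, the next jump has the total rate
    beta(t) and its target is drawn from the measure m(t) of total mass beta(t).
    A transition rate q(. | y, a) is a measure of jumps out of y minus its
    total mass at y, so averaging the drift condition over the policy gives
      int w dm(t) <= beta(t) w(y) + rho w(y) + b.
    Let F(t) = exp(- int_0^t beta), and
      U = int_0^oo e^(- alpha t) beta(t) F(t) dt,
      L = int_0^oo e^(- alpha t) F(t) dt,
      V = int_0^oo e^(- alpha t) (int w dm(t)) F(t) dt.
    Then V <= U w(y) + (rho w(y) + b) L, and U + alpha L <= 1 because alpha +
    beta is a hazard rate whose survival function is e^(- alpha t) F(t)
    ([survival_integral_le1]). Eliminating L,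
      alpha V + rho w(y) U + b U <= alpha w(y) U + rho w(y) + b.
    Multiplying by d_k and integrating, with a_k = E[d_k w(X_k)],
    u_k = E[d_(k+1) w(X_k)] and n_k = E[d_k], this reads
      alpha a_(k+1) + rho u_k + b n_(k+1) <= alpha u_k + rho a_k + b n_k
    ([drift_step]). Summing over k, the terms telescope into
      (alpha - rho) sum_k (a_k - u_k) <= alpha a_0 + b,  where a_0 = w(x).
    Now d_k - d_(k+1) is the integral of alpha e^(- alpha t) over the k-th
    sojourn interval, so the sum is the integral of
    alpha e^(- alpha t) E[w(xi_(t-))] over all times; after the explosion time
    the state is cemetery and contributes 0 ([discounted_occupation]). Since
    the cost is at most M w, dividing by alpha (alpha - rho) gives (b) for the
    initial state x, and integrating over gamma gives the second bound.

    For (a), the policy at time t is carried by A(xi_(t-)), which is A(xi_t)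
    unless t is a jump time; sojourn times have densities, so that has
    probability 0 ([jump_time_no_atom]).

    Two technical points shape the development. The law of the process is
    given on rectangles of histories, times and states, through some
    representation m_k of the intensity that need not be measurable. The
    intensity after the k-th jump is recovered as a measurable function by
    evaluating the policy along the path stopped at that jump ([hazard],
    [representation_hazard]), and the law is extended to functions by treating
    both sides as functionals that commute with nonnegative series
    ([sigma_linear], [next_jump_law]). And the integrands of the statement need
    not be measurable: the integral of a nonnegative function is the supremum
    of the integrals of the simple functions below it, so it is monotone
    without measurability, and this is all that the bounds ask for
    ([abse_integral_le_ae]). *)

(** * Integrals of possibly non-measurable functions *)

Lemma abse_sub_le (R : realDomainType) (a b c : \bar R) :
  0 <= a -> 0 <= b -> a <= c -> b <= c -> `|a - b| <= c.
Proof.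
case: c => [c| |]; last 2 first.
- by move=> *; exact: leey.
- by move=> a0 _ /(le_trans a0).
case: a => [a| |]//; case: b => [b| |]//; rewrite !lee_fin => a0 b0 ac bc.
by rewrite ler_norml; apply/andP; split; lra.
Qed.

Lemma measurable_fun_if_mem d d' (T : measurableType d) (U : measurableType d')
    (N : set T) (g h : T -> U) : measurable N ->
  measurable_fun N g -> measurable_fun (~` N) h ->
  measurable_fun setT (fun x => if x \in N then g x else h x).
Proof.
move=> mN mg mh.
have EN : (fun x => x \in N) @^-1` [set true] = N.
  by apply/seteqP; split=> x /=; [move/set_mem|move/mem_set].
apply: measurable_fun_if => //.
- by apply: (measurable_fun_bool true); rewrite setTI EN.
- by rewrite setTI EN.
- rewrite setTI (_ : _ @^-1` _ = ~` N)//.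
  by apply/seteqP; split=> x /=; [move=> /negbT; rewrite notin_setE|
    rewrite -notin_setE => /negbTE].
Qed.

Section unmeasured_integrals.
Context d (T : measurableType d) (R : realType).
Variable mu : {measure set T -> \bar R}.
Implicit Types (D N : set T) (f g : T -> \bar R).

(** A simple function below [f] is also below [g]. *)
Lemma ge0_le_integral_unmeasured D f g :
  (forall x, D x -> 0 <= f x) -> (forall x, D x -> f x <= g x) ->
  \int[mu]_(x in D) f x <= \int[mu]_(x in D) g x.
Proof.
move=> f0 fg; rewrite !ge0_integralE//; last first.
  by move=> x Dx; exact: le_trans (f0 _ Dx) (fg _ Dx).
apply: le_ereal_sup => _ [h /= hf <-]; exists h => //= x.
apply: le_trans (hf x) _; rewrite !patchE; case: ifPn => // /[!inE].
exact: fg.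
Qed.

Lemma abse_integral_le D f g : (forall x, D x -> `|f x| <= g x) ->
  `|\int[mu]_(x in D) f x| <= \int[mu]_(x in D) g x.
Proof.
move=> fg.
have le1 : \int[mu]_(x in D) f^\+ x <= \int[mu]_(x in D) g x.
  apply: ge0_le_integral_unmeasured => x Dx; first exact: funepos_ge0.
  apply: le_trans (fg _ Dx); rewrite funeposE ge_max abse_ge0 andbT.
  exact: lee_abs.
have le2 : \int[mu]_(x in D) f^\- x <= \int[mu]_(x in D) g x.
  apply: ge0_le_integral_unmeasured => x Dx; first exact: funeneg_ge0.
  apply: le_trans (fg _ Dx); rewrite funenegE ge_max abse_ge0 andbT -abseN.
  exact: lee_abs.
have p0 : 0 <= \int[mu]_(x in D) f^\+ x by exact: integral_ge0.
have n0 : 0 <= \int[mu]_(x in D) f^\- x by exact: integral_ge0.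
by rewrite integralE; exact: abse_sub_le.
Qed.

(** Off the conull set [N] the majorant is completed by +oo, which turns an
    almost-everywhere bound into a pointwise one at no cost in the integral,
    even when [f] and [D] are not measurable. *)
Lemma abse_integral_le_ae D N f g : measurable N -> mu (~` N) = 0 ->
  measurable_fun N g -> (forall x, N x -> 0 <= g x) ->
  (forall x, D x -> N x -> `|f x| <= g x) ->
  `|\int[mu]_(x in D) f x| <= \int[mu]_(x in N) g x.
Proof.
move=> mN N0 mg g0 fg.
pose h x := if x \in N then g x else +oo.
have mh : measurable_fun setT h.
  exact: measurable_fun_if_mem.
have h0 x : 0 <= h x.
  by rewrite /h; case: ifPn => // /[!inE]; exact: g0.
rewrite integral_mkcond.
apply: (@le_trans _ _ (\int[mu]_x h x)).
  apply: abse_integral_le => x _; rewrite patchE.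
  case: ifPn => [/[!inE] Dx|_]; last by rewrite abse0.
  by rewrite /h; case: ifPn => [/[!inE] Nx|_]; [exact: fg|exact: leey].
rewrite (ge0_negligible_integral (measurableC mN))// setTD setCK.
by rewrite (@eq_integral _ _ _ _ _ g)// => x xN; rewrite /h xN.
Qed.

Lemma integral_conull D N f : measurable N -> N `<=` D -> mu (~` N) = 0 ->
  measurable_fun N f -> (forall x, N x -> 0 <= f x) ->
  \int[mu]_(x in D) f x = \int[mu]_(x in N) f x.
Proof.
move=> mN ND N0 mf f0; rewrite integralE.
have -> : \int[mu]_(x in D) f^\- x = 0.
  apply/eqP; rewrite -abse_eq0 eq_le abse_ge0 andbT.
  have <- : \int[mu]_(x in N) cst 0 x = 0 by exact: integral0.
  apply: abse_integral_le_ae => // x Dx Nx.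
  by rewrite gee0_abs ?funeneg_ge0// funenegE ge_max lexx andbT oppe_le0 f0.
rewrite sube0; apply/eqP; rewrite eq_le; apply/andP; split.
  rewrite -[leLHS]gee0_abs ?integral_ge0//.
  apply: abse_integral_le_ae => // x Dx Nx.
  by rewrite gee0_abs// funeposE ge_max lexx f0.
rewrite integral_mkcond [leRHS]integral_mkcond.
apply: ge0_le_integral_unmeasured => x _; rewrite !patchE.
  by case: ifPn => // /[!inE]; exact: f0.
case: ifPn => [/[!inE] Nx|_].
  by rewrite mem_set; [rewrite funeposE le_max lexx|exact: ND].
by case: ifPn => // _; exact: funepos_ge0.
Qed.

End unmeasured_integrals.

(** * Functionals that behave like integrals *)

Lemma nneseriesZl_ge0 (R : realType) (f : nat -> \bar R) (c : \bar R) :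
  0 <= c -> (forall n, 0 <= f n) ->
  \sum_(n <oo) (c * f n) = c * \sum_(n <oo) f n.
Proof.
case: c => [c||]// c0 f0; first by rewrite nneseriesZl.
have [|/forallNP f00] := pselect (exists n, f n <> 0); last first.
  have fE n : f n = 0 by apply: contrapT; exact: f00.
  by rewrite !eseries0 ?mule0// => n _ _; rewrite fE ?mule0.
move=> [k fk]; have fk0 : 0 < f k by rewrite lt_neqAle f0 andbT eq_sym; exact/eqP.
rewrite (@nneseries_pinfty _ (fun n => +oo * f n) _ k)//; last 2 first.
- by move=> n _; exact: mule_ge0.
- by rewrite gt0_mulye.
rewrite gt0_mulye//; apply: (@lt_le_trans _ _ (f k)) => //.
by rewrite (@nneseriesD1 _ _ k)// leeDl// nneseries_ge0.
Qed.

Section sigma_linear.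
Context d (T : measurableType d) (R : realType).
Implicit Types (Phi : (T -> \bar R) -> \bar R) (f : T -> \bar R) (A : set T).

Definition nnmeasurable f := measurable_fun setT f /\ forall x, 0 <= f x.

(** What integration against a measure satisfies, and what is enough to be
    determined by the values at indicators. Working with functionals makes it
    possible to compare two sides of an identity in one argument at a time
    without constructing a measure from either side. *)
Record sigma_linear Phi : Prop := SigmaLinear {
  sigma_linear_ge0 : forall f, nnmeasurable f -> 0 <= Phi f;
  sigma_linearZ : forall (c : R) f, (0 <= c)%R -> nnmeasurable f ->
    Phi (fun x => c%:E * f x) = c%:E * Phi f;
  sigma_linear_series : forall f : (T -> \bar R)^nat,
    (forall n, nnmeasurable (f n)) ->
    Phi (fun x => \sum_(n <oo) f n x) = \sum_(n <oo) Phi (f n) }.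

Lemma nnmeasurable_cst (c : \bar R) : 0 <= c -> nnmeasurable (fun=> c).
Proof. by move=> c0; split. Qed.

Lemma nnmeasurable_indic A : measurable A ->
  nnmeasurable (fun x => (\1_A x)%:E).
Proof.
by move=> mA; split=> [|x]; [exact/measurable_EFinP|rewrite lee_fin].
Qed.

Lemma nnmeasurableD f g : nnmeasurable f -> nnmeasurable g ->
  nnmeasurable (f \+ g).
Proof.
move=> [mf f0] [mg g0]; split; first exact: emeasurable_funD.
by move=> x; exact: adde_ge0.
Qed.

Lemma nnmeasurableM f g : nnmeasurable f -> nnmeasurable g ->
  nnmeasurable (f \* g).
Proof.
move=> [mf f0] [mg g0]; split; first exact: emeasurable_funM.
by move=> x; exact: mule_ge0.
Qed.

Lemma sigma_linear0 Phi : sigma_linear Phi -> Phi (fun=> 0) = 0.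
Proof.
move=> [_ Z _]; have := Z 0%R (fun=> 0) (lexx _) (nnmeasurable_cst (lexx _)).
by under [X in Phi X]eq_fun do rewrite mul0e; rewrite mul0e.
Qed.

Lemma sigma_linearD Phi f g : sigma_linear Phi -> nnmeasurable f ->
  nnmeasurable g -> Phi (f \+ g) = Phi f + Phi g.
Proof.
move=> PL mf mg.
pose h n := if n is 0%N then f else if n is 1%N then g else fun=> 0.
have mh n : nnmeasurable (h n).
  by case: n => [|[|n]]//=; exact: nnmeasurable_cst.
have two (u : nat -> \bar R) : (forall n, 0 <= u n) -> (forall n, u n.+2 = 0) ->
    \sum_(n <oo) u n = u 0%N + u 1%N.
  move=> u0 u2; rewrite (nneseries_split _ 2)// add0n [X in _ + X]eseries0 ?adde0.
    by rewrite big_nat_recr//= big_nat1.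
  by move=> [|[|n]].
have := sigma_linear_series PL mh.
rewrite two.
- by under [X in Phi X]eq_fun do [rewrite two//; last by move=> n; exact: (mh n).2].
- by move=> n; apply: sigma_linear_ge0.
- by move=> n /=; exact: sigma_linear0.
Qed.

Import HBSimple HBNNSimple.

(** A nonnegative measurable function is the series of the increments of its
    approximation by simple functions, and a nonnegative simple function is a
    finite combination of indicators. *)
Lemma sigma_linear_ext Phi1 Phi2 : sigma_linear Phi1 -> sigma_linear Phi2 ->
  (forall A, measurable A ->
    Phi1 (fun x => (\1_A x)%:E) = Phi2 (fun x => (\1_A x)%:E)) ->
  forall f, nnmeasurable f -> Phi1 f = Phi2 f.
Proof.
move=> L1 L2 E f [mf f0].
have sfin (g : {sfun T >-> R}) : (forall x, 0 <= g x)%R ->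
    Phi1 (EFin \o g) = Phi2 (EFin \o g).
  move=> g0.
  have gE : EFin \o g = fun x => \sum_(r <- fset_set (range g))
      (`|r|%:E * (\1_(g @^-1` [set r]) x)%:E).
    apply/funext => x /=; rewrite fimfunE fsbig_finite//= -sumEFin.
    (* for a value [r] of [g] the coefficient [`|r|] is [r]; written this way
       it is nonnegative without reference to the range of [g] *)
    rewrite big_seq [RHS]big_seq; apply: eq_bigr => r.
    rewrite in_fset_set// inE => -[y _ <-].
    by rewrite EFinM ger0_norm.
  rewrite gE; move: (fset_set _) => F.
  elim: (enum_fset F) => [|r s ih].
    under eq_fun do rewrite big_nil.
    by rewrite !sigma_linear0.
  have mr : nnmeasurable (fun x => `|r|%:E * (\1_(g @^-1` [set r]) x)%:E).
    by apply: nnmeasurableM; [exact: nnmeasurable_cst|exact: nnmeasurable_indic].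
  have ms : nnmeasurable (fun x => \sum_(r <- s)
      (`|r|%:E * (\1_(g @^-1` [set r]) x)%:E)).
    split=> [|x]; last first.
      by apply: sume_ge0 => *; rewrite mule_ge0// lee_fin.
    apply: emeasurable_sum => // r'.
    apply: (@nnmeasurableM _ _ _ _).1; first exact: nnmeasurable_cst.
    exact: nnmeasurable_indic.
  under eq_fun do rewrite big_cons.
  rewrite (sigma_linearD L1 mr ms) (sigma_linearD L2 mr ms) ih.
  by rewrite !sigma_linearZ ?E//; exact: nnmeasurable_indic.
pose h := nnsfun_approx measurableT mf.
pose u n : {sfun T >-> R} := if n is m.+1
    then ((h m.+1 : {sfun T >-> R}) - (h m : {sfun T >-> R}))%R else h 0%N.
have u0 n x : (0 <= u n x)%R.
  case: n => [|n] /=; first exact: fun_ge0.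
  by rewrite subr_ge0; have /lefP := nd_nnsfun_approx measurableT mf (leqnSn n); exact.
have mu n : nnmeasurable (EFin \o u n).
  by split=> [|x]; [exact/measurable_EFinP|rewrite lee_fin].
have fE : f = fun x => \sum_(n <oo) (EFin \o u n) x.
  apply/funext => x; apply/esym/cvg_lim => //.
  rewrite (_ : (fun n => _) = (fun n => if n is m.+1 then (h m x)%:E else 0)); last first.
    apply/funext => -[|n] /=; first by rewrite big_geq.
    elim: n => [|n ih]; first by rewrite big_nat1.
    by rewrite big_nat_recr//= ih -EFinD addrC subrK.
  rewrite -(cvg_shiftS) /=.
  exact: (cvg_nnsfun_approx measurableT mf (fun x _ => f0 x)).
rewrite fE (sigma_linear_series L1 mu) (sigma_linear_series L2 mu).
by apply: eq_eseriesr => n _; exact: sfin.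
Qed.

(** Finiteness at 1 is what allows complements to be subtracted, so that the
    sets on which the functionals agree form a Dynkin system. *)
Lemma sigma_linear_ext_pi (G : set (set T)) Phi1 Phi2 :
  measurable = <<s G>> -> setI_closed G ->
  sigma_linear Phi1 -> sigma_linear Phi2 ->
  Phi1 (fun=> 1) < +oo -> Phi1 (fun=> 1) = Phi2 (fun=> 1) ->
  (forall A, G A ->
    Phi1 (fun x => (\1_A x)%:E) = Phi2 (fun x => (\1_A x)%:E)) ->
  forall f, nnmeasurable f -> Phi1 f = Phi2 f.
Proof.
move=> mG GI L1 L2 fin1 E1 EG; apply: sigma_linear_ext => // A.
rewrite {1}mG; move: A; apply: (@dynkin_induction _ _ G (fun A =>
    Phi1 (fun x => (\1_A x)%:E) = Phi2 (fun x => (\1_A x)%:E))) => //.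
- by rewrite indicT.
- move=> A mA EA.
  have m1 := nnmeasurable_indic mA.
  have m2 := nnmeasurable_indic (measurableC mA).
  have split1 : (fun=> 1 : \bar R) =
      (fun x => (\1_A x)%:E) \+ (fun x => (\1_(~` A) x)%:E) :> (T -> \bar R).
    apply/funext => x /=; rewrite !indicE in_setC.
    by case: (x \in A); rewrite /= ?adde0 ?add0e.
  have fA : Phi1 (fun x => (\1_A x)%:E) \is a fin_num.
    rewrite ge0_fin_numE ?sigma_linear_ge0//; apply: le_lt_trans fin1.
    by rewrite split1 (sigma_linearD L1 m1 m2) leeDl// sigma_linear_ge0.
  move: E1; rewrite split1 (sigma_linearD L1 m1 m2) (sigma_linearD L2 m1 m2) -EA.
  move/(congr1 (fun z => z - Phi1 (fun x => (\1_A x)%:E))).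
  by rewrite ![_ + _ - _]addeAC !subee// !add0e.
- move=> F mF tF EF.
  have -> : (fun x => (\1_(\bigcup_k F k) x)%:E) =
      (fun x => \sum_(n <oo) (\1_(F n) x)%:E : \bar R).
    by apply/funext => x; rewrite indic_bigcup.
  have mFn n := nnmeasurable_indic (mF n).
  rewrite (sigma_linear_series L1 mFn) (sigma_linear_series L2 mFn).
  by apply: eq_eseriesr => n _; exact: EF.
Qed.

Lemma sigma_linearM (c : \bar R) Phi : 0 <= c -> sigma_linear Phi ->
  sigma_linear (fun f => c * Phi f).
Proof.
move=> c0 L; split.
- by move=> f mf; rewrite mule_ge0// sigma_linear_ge0.
- by move=> a f a0 mf; rewrite sigma_linearZ// muleCA.
- move=> f mf; rewrite sigma_linear_series// nneseriesZl_ge0// => n.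
  by apply: sigma_linear_ge0.
Qed.

Lemma sigma_linear_int d' (U : measurableType d') (mu : {measure set U -> \bar R})
    (D : set U) (Psi : U -> (T -> \bar R) -> \bar R) : measurable D ->
  (forall z, D z -> sigma_linear (Psi z)) ->
  (forall f, nnmeasurable f -> measurable_fun D (Psi ^~ f)) ->
  sigma_linear (fun f => \int[mu]_(z in D) Psi z f).
Proof.
move=> mD L mPsi; split.
- by move=> f mf; apply: integral_ge0 => z Dz; have := sigma_linear_ge0 (L _ Dz) mf.
- move=> c f c0 mf.
  have f0 z : D z -> 0 <= Psi z f by move=> Dz; have := sigma_linear_ge0 (L _ Dz) mf.
  rewrite -(ge0_integralZl mu mD (mPsi _ mf) f0)//.
  by apply: eq_integral => z /[!inE] Dz; rewrite (sigma_linearZ (L _ Dz) c0 mf).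
- move=> f mf.
  have f0 n z : D z -> 0 <= Psi z (f n).
    by move=> Dz; have := sigma_linear_ge0 (L _ Dz) (mf n).
  rewrite -(integral_nneseries mu mD (fun n => mPsi _ (mf n)) f0)//.
  by apply: eq_integral => z /[!inE] Dz; rewrite (sigma_linear_series (L _ Dz) mf).
Qed.

Lemma sigma_linear_eval x : sigma_linear (fun f => f x).
Proof. by split=> // f mf; exact: mf.2. Qed.

Lemma sigma_linear_integral (mu : {measure set T -> \bar R}) :
  sigma_linear (fun f => \int[mu]_x f x).
Proof.
apply: (@sigma_linear_int _ _ mu setT (fun x f => f x)) => //.
- by move=> x _; exact: sigma_linear_eval.
- by move=> f [].
Qed.

End sigma_linear.

Lemma nnmeasurable1 d (T : measurableType d) (R : realType) :
  nnmeasurable (cst 1 : T -> \bar R).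
Proof. by split. Qed.

Lemma indic_rectangle (R : realType) T1 T2 (A : set T1) (B : set T2) z :
  (\1_(A `*` B) z = \1_A z.1 * \1_B z.2 :> R)%R.
Proof. by rewrite !indicE in_setX -natrM mulnb. Qed.

Lemma sigma_linear_ext_prod d1 d2 (T1 : measurableType d1)
    (T2 : measurableType d2) (R : realType)
    (Phi1 Phi2 : (T1 * T2 -> \bar R) -> \bar R) :
  sigma_linear Phi1 -> sigma_linear Phi2 ->
  Phi1 (fun=> 1) < +oo ->
  (forall A B, measurable A -> measurable B ->
    Phi1 (fun z => (\1_A z.1)%:E * (\1_B z.2)%:E) =
    Phi2 (fun z => (\1_A z.1)%:E * (\1_B z.2)%:E)) ->
  forall f, nnmeasurable f -> Phi1 f = Phi2 f.
Proof.
move=> L1 L2 fin1 E.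
pose G := [set A `*` B | A in @measurable _ T1 & B in @measurable _ T2].
have EG A B : measurable A -> measurable B ->
    Phi1 (fun x => (\1_(A `*` B) x)%:E) = Phi2 (fun x => (\1_(A `*` B) x)%:E).
  move=> mA mB; under eq_fun do rewrite indic_rectangle EFinM.
  by rewrite E.
apply: (@sigma_linear_ext_pi _ _ _ G) => //.
- exact: measurable_prod_measurableType.
- move=> _ _ [X1 mX1 [X2 mX2 <-]] [Y1 mY1 [Y2 mY2 <-]].
  exists (X1 `&` Y1); first exact: measurableI.
  by exists (X2 `&` Y2); [exact: measurableI|rewrite setXI].
- by have := EG _ _ measurableT measurableT; rewrite setXTT indicT.
- by move=> _ [A mA [B mB <-]]; exact: EG.
Qed.

(** Packing a family of measures of uniformly bounded mass as a finite kernel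
    gives access to the measurability of integrals depending on a parameter. *)
Section bounded_family.
Context d d' (X : measurableType d) (Y : measurableType d') (R : realType).
Variables (l : X -> {measure set Y -> \bar R}) (c : R).
Hypothesis ml : forall U, measurable U -> measurable_fun setT (l ^~ U).
Hypothesis lc : forall x, l x setT < c%:E.

Definition bounded_family := fun (_ : forall x, l x setT < c%:E) => l.

HB.instance Definition _ := isKernel.Build _ _ X Y R (bounded_family lc) ml.

Let bounded_family_uub : measure_fam_uub (bounded_family lc).
Proof. by exists c. Qed.

HB.instance Definition _ :=
  Kernel_isFinite.Build _ _ X Y R (bounded_family lc) bounded_family_uub.

Lemma measurable_fun_integral_bounded (f : X * Y -> \bar R) :
  nnmeasurable f -> measurable_fun setT (fun x => \int[l x]_y f (x, y)).
Proof.
by move=> [mf f0]; exact: (measurable_fun_integral_finite_kernel f (bounded_family lc)).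
Qed.

End bounded_family.

(** * Paths: times, states and measurability *)

Section option_measurability.
Context d (S : measurableType d).

Lemma measurable_fun_option d' (T : measurableType d') (f : option S -> T) :
  measurable_fun setT (f \o Some) -> measurable_fun setT f.
Proof.
by move=> mf _ B mB; have := mf measurableT B mB; rewrite !setTI.
Qed.

Lemma measurable_None : measurable [set (None : option S)].
Proof.
rewrite /measurable/= /option_measurable/= (_ : _ @^-1` _ = set0)//.
by apply/seteqP; split.
Qed.

Lemma measurable_image_Some (D : set S) : measurable D ->
  measurable (Some @` D : set (option S)).
Proof.
move=> mD; rewrite /measurable/= /option_measurable/= (_ : _ @^-1` _ = D)//.
by apply/seteqP; split=> x /= => [[y Dy [<-]]|Dx]//; exists x.
Qed.

Lemma measurable_odflt (x0 : S) : measurable_fun setT (odflt x0).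
Proof. by apply: measurable_fun_option; exact: measurable_id. Qed.

Lemma measurable_at_state (R : realType) (u : S -> \bar R) :
  measurable_fun setT u -> measurable_fun setT (fun x => at_state x u).
Proof. by move=> mu; exact: measurable_fun_option. Qed.

Lemma at_state_ge0 (R : realType) (u : S -> \bar R) x : (forall y, 0 <= u y) ->
  0 <= at_state x u.
Proof. by case: x => [y|] u0; [exact: u0|exact: lexx]. Qed.

End option_measurability.

Lemma measurable_expeR (R : realType) : measurable_fun setT (@expeR R).
Proof.
rewrite (_ : expeR = fun x : \bar R => if x == +oo then +oo else
    if x == -oo then 0 else (expR (fine x))%:E); last first.
  by apply/funext => -[x| |].
apply: measurable_fun_ifT => //; first exact: measurable_fun_eqe.
apply: measurable_fun_ifT => //; first exact: measurable_fun_eqe.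
by apply/measurable_EFinP; apply: measurableT_comp.
Qed.

Section path_theory.
Context d (S : measurableType d) (R : realType).
Implicit Types (e : Defs.path S R) (k l : nat) (t : R).

Lemma path_sojourn_gt0 e k : 0 < path_sojourn e k.
Proof.
have [h|[k0 [_ h _ h']]] := Defs.pathP e; first by have [_ /andP[]] := h k.
have [kk0|k0k] := ltnP k k0; first by have /andP[] := h _ kk0.
by rewrite h'.
Qed.

Lemma path_sojourn_finP e k :
  path_sojourn e k < +oo <-> path_state e k.+1 <> None.
Proof.
have [h|[k0 [hx ht hx' ht']]] := Defs.pathP e.
  by split=> _; [exact: (h k.+1).1|have [_ /andP[]] := h k].
have [kk0|kk0] := ltnP k k0; first by split=> _; [exact: hx|have /andP[] := ht _ kk0].
by split; [rewrite ht'|rewrite hx'].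
Qed.

Lemma path_state0 e : path_state e 0 <> None.
Proof.
have [h|[k0 [hx ht hx' ht']]] := Defs.pathP e; first exact: (h 0%N).1.
exact: hx.
Qed.

Lemma path_stateS e k : path_state e k.+1 <> None -> path_state e k <> None.
Proof.
have [h|[k0 [hx ht hx' ht']]] := Defs.pathP e; first by move=> _; exact: (h k).1.
have [kk0|k0k] := ltnP k k0; last by rewrite hx'.
by move=> _; exact: hx (ltnW kk0).
Qed.

Lemma jump_time0 e : jump_time e 0 = 0.
Proof. by rewrite /jump_time big_ord0. Qed.

Lemma jump_timeS e k : jump_time e k.+1 = jump_time e k + path_sojourn e k.
Proof. by rewrite /jump_time big_ord_recr. Qed.

Lemma jump_time_ge0 e k : 0 <= jump_time e k.
Proof. by apply: sume_ge0 => i _; exact/ltW/path_sojourn_gt0. Qed.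

Lemma jump_time_finP e k : jump_time e k < +oo <-> path_state e k <> None.
Proof.
elim: k => [|k ih]; first by rewrite jump_time0; split=> // _; exact: path_state0.
rewrite jump_timeS; split=> [|xS].
  move=> h; apply/path_sojourn_finP; apply: le_lt_trans h.
  by rewrite leeDr// jump_time_ge0.
by rewrite lte_add_pinfty//; [exact/ih/path_stateS|exact/path_sojourn_finP].
Qed.

Lemma jump_time_fin_num e k : path_state e k <> None ->
  jump_time e k \is a fin_num.
Proof. by move=> /jump_time_finP h; rewrite ge0_fin_numE// jump_time_ge0. Qed.

Lemma le_jump_time e k l : (k <= l)%N -> jump_time e k <= jump_time e l.
Proof.
move=> /subnK <-; elim: (l - k)%N => // n ih; rewrite addSn jump_timeS.
by apply: le_trans ih _; rewrite leeDl// ltW// path_sojourn_gt0.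
Qed.

Lemma nneseries_single (f : nat -> \bar R) k : (forall n, 0 <= f n) ->
  (forall n, n <> k -> f n = 0) -> \sum_(n <oo) f n = f k.
Proof.
move=> f0 fk; rewrite (@nneseriesD1 _ _ k)// [X in _ + X]eseries0 ?adde0//.
by move=> n _ /eqP; exact: fk.
Qed.

Lemma jump_index_oc e t k l : jump_time e k < t%:E <= jump_time e k.+1 ->
  jump_time e l < t%:E <= jump_time e l.+1 -> k = l.
Proof.
move=> /andP[k1 k2] /andP[l1 l2].
apply/eqP; rewrite eqn_leq; apply/andP; split; rewrite leqNgt; apply/negP.
  by move=> /(le_jump_time e); rewrite leNgt (lt_le_trans k1 l2).
by move=> /(le_jump_time e); rewrite leNgt (lt_le_trans l1 k2).
Qed.

Lemma jump_index_co e t k l : jump_time e k <= t%:E < jump_time e k.+1 ->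
  jump_time e l <= t%:E < jump_time e l.+1 -> k = l.
Proof.
move=> /andP[k1 k2] /andP[l1 l2].
apply/eqP; rewrite eqn_leq; apply/andP; split; rewrite leqNgt; apply/negP.
  by move=> /(le_jump_time e); rewrite leNgt (le_lt_trans k1 l2).
by move=> /(le_jump_time e); rewrite leNgt (le_lt_trans l1 k2).
Qed.

Section selected_state.
Variables (I : nat -> bool) (x : nat -> option S).
Hypothesis I_uniq : forall k l, I k -> I l -> k = l.

(** [xi] and [xi_left] select the state of the sojourn interval that contains
    the time; as these intervals are disjoint, the selection is a function of
    the index alone. *)
Lemma xget_selected k : I k -> xget None [set z | exists2 k, I k & z = x k] = x k.
Proof.
move=> Ik; case: xgetP => [z _ [l Il ->]|/(_ (x k))[]]; last by exists k.
by rewrite (I_uniq Ik Il).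
Qed.

(** A selection becomes a countable sum with at most one nonzero term, whose
    measurability can be read off term by term. *)
Lemma at_xget_series (u : S -> \bar R) : (forall y, 0 <= u y) ->
  at_state (xget None [set z | exists2 k, I k & z = x k]) u =
  \sum_(k <oo) if I k then at_state (x k) u else 0.
Proof.
move=> u0; have [[k Ik]|/forallNP no] := pselect (exists k, I k); last first.
  rewrite eseries0 => [|k _ _]; last by rewrite (negbTE (introN idP (no k))).
  by case: xgetP => // z _ [k /no].
rewrite (xget_selected Ik) (@nneseries_single _ k) ?Ik//.
  by move=> n; case: ifP => // _; exact: at_state_ge0.
by move=> n nk; case: ifPn => // In; case: nk; exact: I_uniq.
Qed.

End selected_state.

Lemma xi_leftE e t k : jump_time e k < t%:E <= jump_time e k.+1 ->
  xi_left e t = path_state e k.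
Proof.
move=> tk; rewrite /xi_left ifF.
  exact: (xget_selected (path_state e) (@jump_index_oc e t) tk).
apply/eqP => t0; move: tk => /andP[+ _]; rewrite t0.
by rewrite ltNge jump_time_ge0.
Qed.

Lemma xiE e t k : jump_time e k <= t%:E < jump_time e k.+1 ->
  xi e t = path_state e k.
Proof. exact: (xget_selected (path_state e) (@jump_index_co e t)). Qed.

Lemma at_xi_series e t (u : S -> \bar R) : (forall y, 0 <= u y) ->
  at_state (xi e t) u = \sum_(k <oo)
    if jump_time e k <= t%:E < jump_time e k.+1
    then at_state (path_state e k) u else 0.
Proof. exact: (at_xget_series (path_state e) (@jump_index_co e t)). Qed.

Lemma at_xi_left_series e t (u : S -> \bar R) : (0 < t)%R ->
  (forall y, 0 <= u y) ->
  at_state (xi_left e t) u = \sum_(k <oo)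
    if jump_time e k < t%:E <= jump_time e k.+1
    then at_state (path_state e k) u else 0.
Proof.
move=> t0 u0; rewrite /xi_left gt_eqF//.
exact: (at_xget_series (path_state e) (@jump_index_oc e t)).
Qed.

Lemma xi_xi_left e t : (0 <= t)%R -> (forall k, jump_time e k.+1 <> t%:E) ->
  xi e t = xi_left e t.
Proof.
move=> t0 nojump; have [->|tn0] := eqVneq t 0%R.
  rewrite /xi_left eqxx; apply: xiE; rewrite jump_time0 lexx jump_timeS.
  by rewrite jump_time0 add0e path_sojourn_gt0.
have {tn0}t0 : (0 < t)%R by rewrite lt_neqAle eq_sym tn0.
have I k : (jump_time e k < t%:E <= jump_time e k.+1) =
    (jump_time e k <= t%:E < jump_time e k.+1).
  rewrite !lt_neqAle [t%:E == _]eq_sym (introN eqP (nojump k)) /=; congr (_ && _).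
  case: k => [|k]; last by rewrite (introN eqP (nojump k)).
  by rewrite jump_time0 eqe eq_sym gt_eqF.
rewrite /xi_left gt_eqF//; congr (xget _ _).
by apply/seteqP; split=> x [k]; [rewrite -I|rewrite I]; exists k.
Qed.

(** Absorbing a path after its [k]-th jump gives again a path. If it is already
    absorbed at some step [k0], the stopped path is absorbed at the first of
    the two. *)
Lemma stop_pathP e k :
  let x l := if (l <= k)%N then path_state e l else None in
  let theta l := if (l < k)%N then path_sojourn e l else +oo in
  (forall l, x l <> None /\ 0 < theta l < +oo) \/
  (exists n, [/\ forall l, (l <= n)%N -> x l <> None,
                 forall l, (l < n)%N -> 0 < theta l < +oo,
                 forall l, (n < l)%N -> x l = None &
                 forall l, (n <= l)%N -> theta l = +oo]).
Proof.
move=> x theta; right.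
have [h|[k0 [hx ht hx' ht']]] := Defs.pathP e.
  exists k; split=> l lk; rewrite /x /theta ?lk//.
  - exact: (h l).1.
  - exact: (h l).2.
  - by rewrite leqNgt lk.
  - by rewrite ltnNge lk.
exists (minn k k0); split=> l; rewrite /x /theta.
- by rewrite leq_min => /andP[-> /hx].
- by rewrite leq_min => /andP[-> /ht].
- by rewrite gtn_min => /orP[kl|/hx' ->]; [rewrite leqNgt kl|case: ifP].
- by rewrite geq_min => /orP[kl|/ht' ->]; [rewrite ltnNge kl|case: ifP].
Qed.

(** Stopping keeps the [k]-th history and makes every later time belong to the
    [k]-th sojourn interval. The intensity after the [k]-th jump is thereby
    defined for all times, as a function of the history. *)
Definition stop_path k e : Defs.path S R := Path (stop_pathP e k).

Lemma stop_path_state k e l : (l <= k)%N ->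
  path_state (stop_path k e) l = path_state e l.
Proof. by rewrite /= => ->. Qed.

Lemma stop_path_jump_time k e l : (l <= k)%N ->
  jump_time (stop_path k e) l = jump_time e l.
Proof.
move=> lk; apply: eq_bigr => i _ /=.
by rewrite (leq_trans (ltn_ord i) lk).
Qed.

Lemma stop_path_jump_timeS k e : jump_time (stop_path k e) k.+1 = +oo.
Proof.
rewrite jump_timeS /= ltnn addey// gt_eqF//.
by apply: lt_le_trans (jump_time_ge0 _ _); rewrite ltNy0.
Qed.

Lemma hist_stop_path k e : hist k (stop_path k e) = hist k e.
Proof.
congr (_, _); apply: eq_from_tnth => i; rewrite !tnth_mktuple /=.
  by rewrite -ltnS ltn_ord.
by rewrite ltn_ord.
Qed.

Lemma xi_left_stop_path k e t : path_state e k <> None -> (0 < t)%R ->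
  jump_time (stop_path k e) k < (fine (jump_time e k) + t)%:E <=
    jump_time (stop_path k e) k.+1.
Proof.
move=> xk t0; rewrite stop_path_jump_time// stop_path_jump_timeS leey andbT.
by rewrite EFinD fineK ?jump_time_fin_num// lteDl ?jump_time_fin_num.
Qed.

End path_theory.

Section path_measurability.
Context d (S : measurableType d) (R : realType).
Local Notation Om := (Omega S R).

Lemma measurable_path_state k :
  measurable_fun setT (fun e : Om => path_state e k).
Proof.
move=> _ B mB; rewrite setTI; apply: sub_sigma_algebra.
by left; exists k, B.
Qed.

Lemma measurable_path_sojourn k :
  measurable_fun setT (fun e : Om => path_sojourn e k).
Proof.
move=> _ B mB; rewrite setTI; apply: sub_sigma_algebra.
by right; exists k, B.
Qed.

Lemma measurable_into_paths d' (T : measurableType d') (f : T -> Om) :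
  (forall k, measurable_fun setT (fun x => path_state (f x) k)) ->
  (forall k, measurable_fun setT (fun x => path_sojourn (f x) k)) ->
  measurable_fun setT f.
Proof.
move=> mx mt; apply: (@measurability _ _ _ Om _ f (@coordinate_sets d S R)) => //.
move=> _ [C [[k [B [mB ->]]]|[k [B [mB ->]]]] <-]; rewrite setTI.
  by have := mx k measurableT B mB; rewrite setTI.
by have := mt k measurableT B mB; rewrite setTI.
Qed.

Lemma measurable_jump_time k : measurable_fun setT (fun e : Om => jump_time e k).
Proof. by apply: emeasurable_sum => i; exact: measurable_path_sojourn. Qed.

Lemma measurable_jump_at k (t : R) :
  measurable [set e : Om | jump_time e k = t%:E].
Proof.
rewrite (_ : [set e | _] = (fun e : Om => jump_time e k) @^-1` [set t%:E])//.
by rewrite -[X in measurable X]setTI; exact: measurable_jump_time.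
Qed.

Lemma measurable_hist k : measurable_fun setT (fun e : Om => hist k e).
Proof.
apply: measurable_fun_pair; apply/measurable_fun_tnthP => i.
  rewrite (_ : _ \o _ = fun e : Om => path_state e i).
    exact: measurable_path_state.
  by apply/funext => e /=; rewrite tnth_mktuple.
rewrite (_ : _ \o _ = fun e : Om => path_sojourn e i).
  exact: measurable_path_sojourn.
by apply/funext => e /=; rewrite tnth_mktuple.
Qed.

Lemma measurable_stop_path k : measurable_fun setT (stop_path k : Om -> Om).
Proof.
apply: measurable_into_paths => l /=.
  by case: (l <= k)%N => //; exact: measurable_path_state.
by case: (l < k)%N => //; exact: measurable_path_sojourn.
Qed.

Definition alive k : set Om := [set e | path_state e k <> None].

Lemma measurable_alive k : measurable (alive k).
Proof.
have := measurable_path_state k measurableT (measurableC (@measurable_None _ S)).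
by rewrite setTI.
Qed.

Lemma measurable_jump_measure (B : set (\bar R * option S)) : measurable B ->
  measurable_fun setT (fun e : Om => jump_measure e B).
Proof.
move=> mB; rewrite /jump_measure.
under eq_fun do rewrite eseries_mkcond.
apply: ge0_emeasurable_sum => // [k e _ _|k _]; first by case: ifP.
apply: measurable_fun_ifT => //.
  by apply: measurable_fun_lte => //; exact: measurable_jump_time.
apply/measurable_EFinP.
apply: (@measurableT_comp _ _ _ _ _ _ (\1_B : _ -> R) _
  (fun e : Om => (jump_time e k, path_state e k))) => //.
by apply: measurable_fun_pair; [exact: measurable_jump_time|exact: measurable_path_state].
Qed.

Lemma past_measurable t (C : set (Defs.path S R)) : past t C -> measurable (C : set Om).
Proof.
apply: smallest_sub; first exact: sigma_algebra_measurable.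
move=> _ [s [D [B [st mD mB ->]]]].
have mZ : measurable [set z : \bar R * option S |
    0 <= z.1 <= s%:E /\ (Some @` D) z.2].
  rewrite (_ : [set _ | _] = `[0, s%:E] `*` (Some @` D)).
    by apply: measurableX; [exact: emeasurable_itv|exact: measurable_image_Some].
  by apply/seteqP; split=> z /=; rewrite in_itv.
by have := measurable_jump_measure mZ measurableT mB; rewrite setTI.
Qed.

Lemma strict_past_measurable t (C : set (Defs.path S R)) :
  strict_past t C -> measurable (C : set Om).
Proof.
apply: smallest_sub; first exact: sigma_algebra_measurable.
by move=> A [s _]; exact: past_measurable.
Qed.

(** Only measurability with respect to the whole sigma-algebra of [Omega] is
    asked of [f]: a predictable rectangle is in particular a product of a
    measurable set of paths and an interval of times. *)
Lemma measurable_into_predictable d' (T : measurableType d') (f : T -> Om)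
    (g : T -> R) : measurable_fun setT f -> measurable_fun setT g ->
  measurable_fun setT (fun x => (f x, to_time (g x)) : predictable S R).
Proof.
move=> mf mg.
apply: (@measurability _ _ _ (predictable S R) _ _
  (@predictable_rectangles d S R)) => //.
move=> _ [Z [[B pB <-]|[C [s [s0 pC ->]]]] <-]; rewrite setTI.
  rewrite (_ : _ @^-1` _ = (f @^-1` B) `&` (g @^-1` [set 0%R])).
    apply: measurableI; rewrite -[X in measurable X]setTI.
      by apply: mf => //; exact: past_measurable pB.
    exact: mg.
  apply/seteqP; split=> x /= [fB]; last first.
    by move=> ->.
  move=> /(congr1 (fun t : time R => t%:num)) /= /eqP.
  by rewrite normr0 normr_eq0 => /eqP.
rewrite (_ : _ @^-1` _ = (f @^-1` C) `&` ((fun x => `|g x|%R) @^-1` `]s, +oo[)).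
  apply: measurableI; rewrite -[X in measurable X]setTI.
    by apply: mf => //; exact: strict_past_measurable pC.
  by apply: (measurableT_comp _ mg) => //; exact: measurable_normr.
by apply/seteqP; split=> x /= [fC]; rewrite in_itv/= andbT.
Qed.

Definition after_jump k (z : Om * R) : predictable S R :=
  (stop_path k z.1, to_time (fine (jump_time z.1 k) + z.2)).

Lemma measurable_after_jump k : measurable_fun setT (after_jump k).
Proof.
apply: measurable_into_predictable.
  by apply: measurableT_comp (measurable_stop_path k) _.
apply: measurable_funD => //.
apply: measurableT_comp => //.
exact: measurableT_comp (measurable_jump_time k) _.
Qed.

Lemma measurable_at_xi_left (u : S -> \bar R) : nnmeasurable u ->
  measurable_fun setT (fun z : Om * R => if (0 < z.2)%R then
    at_state (xi_left z.1 z.2) u else 0).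
Proof.
move=> [mu u0].
rewrite (_ : (fun z => _) = fun z : Om * R => if (0 < z.2)%R then \sum_(k <oo)
    (if jump_time z.1 k < z.2%:E <= jump_time z.1 k.+1
    then at_state (path_state z.1 k) u else 0) else 0); last first.
  by apply/funext => -[e t] /=; case: ifPn => // t0; exact: at_xi_left_series.
have m2 : measurable_fun setT (fun z : Om * R => z.2%:E).
  exact/measurable_EFinP.
have mT k : measurable_fun setT (fun z : Om * R => jump_time z.1 k).
  exact: measurableT_comp (measurable_jump_time k) _.
apply: measurable_fun_ifT => //.
  exact: (measurable_fun_lte (measurable_cst 0) m2).
apply: ge0_emeasurable_sum => // [k e _ _|k _].
  by case: ifP => // _; exact: at_state_ge0.
apply: measurable_fun_ifT => //.
  by apply: measurable_and; [exact: measurable_fun_lte|exact: measurable_fun_lee].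
apply: (measurableT_comp (measurable_at_state mu)).
exact: measurableT_comp (measurable_path_state k) _.
Qed.

Lemma measurable_at_xi t (u : S -> \bar R) : nnmeasurable u ->
  measurable_fun setT (fun e : Om => at_state (xi e t) u).
Proof.
move=> [mu u0]; under eq_fun do rewrite at_xi_series//.
apply: ge0_emeasurable_sum => // [k e _ _|k _].
  by case: ifP => // _; exact: at_state_ge0.
apply: measurable_fun_ifT => //.
  apply: measurable_and.
    by apply: measurable_fun_lee => //; exact: measurable_jump_time.
  by apply: measurable_fun_lte => //; exact: measurable_jump_time.
exact: (measurableT_comp (measurable_at_state mu) (measurable_path_state k)).
Qed.

Lemma nnmeasurable_hist k (f : history S R k * R -> \bar R) : nnmeasurable f ->
  nnmeasurable (fun z : Om * R => f (hist k z.1, z.2)).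
Proof.
move=> [mf f0]; split=> //.
apply: (measurableT_comp mf (g := fun z : Om * R => (hist k z.1, z.2))).
have mh : measurable_fun setT (fun z : Om * R => hist k z.1).
  exact: (measurableT_comp (@measurable_hist k) measurable_fst).
exact: (measurable_fun_pair mh measurable_snd).
Qed.

Lemma measurable_hist_sojourn k (f : history S R k * R -> \bar R) :
  nnmeasurable f ->
  measurable_fun setT (fun e : Om => f (hist k e, fine (path_sojourn e k))).
Proof.
move=> [mf f0].
apply: (measurableT_comp mf (g := fun e : Om => (hist k e, fine (path_sojourn e k)))).
apply: measurable_fun_pair; first exact: measurable_hist.
exact: measurableT_comp (measurable_path_sojourn k).
Qed.

Lemma measurable_at_path_state k (u : S -> \bar R) : nnmeasurable u ->
  measurable_fun setT (fun e : Om => at_state (path_state e k) u).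
Proof.
move=> [mu _].
exact: (measurableT_comp (measurable_at_state mu) (measurable_path_state k)).
Qed.

End path_measurability.

(** * The diagonal of a Polish space *)

Section diagonal.
Context (R : realType) (T : completePseudoMetricType R).

(** Two distinct points are separated by one of countably many balls with
    centers in a dense set, so the complement of the diagonal is a countable
    union of rectangles. *)
Lemma polish_measurable_diagonal : polish T ->
  measurable [set z : borel T * borel T | z.1 = z.2].
Proof.
move=> [hausT [D /countable_injP[f injf] denseD]].
(* [g] lists the dense points by their codes; at other numbers its value is
   immaterial, as the rectangles below avoid the diagonal for any center *)
pose g n := xget point [set x | D x /\ f x = n].
pose O n m : set T := (ball (g n) m.+1%:R^-1%R)^°.
have mO n m : measurable (O n m : set (borel T)).
  by apply: sub_sigma_algebra; exact: open_interior.
rewrite -[X in measurable X]setCK; apply: measurableC.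
rewrite (_ : ~` _ = \bigcup_n \bigcup_m
    ((O n m : set (borel T)) `*` (~` O n m : set (borel T)))); last first.
  apply/seteqP; split=> [[x y] /= xy|[x y] [n _] [m _] [/= Ox nOy] xy]; last first.
    by apply: nOy; rewrite -xy.
  have {}xy : (x : T) != y by exact/eqP.
  move: hausT; rewrite open_hausdorff => /(_ _ _ xy) [[U V] /= [xU yV] [oU _ UV0]].
  rewrite !inE in xU yV.
  have [e /= e0 xeU] : exists2 e : R, (0 < e)%R & ball x e `<=` U.
    by move: oU; rewrite openE => /(_ _ xU); rewrite /interior -nbhs_ballE.
  have [m me] : exists m, (m.+1%:R^-1 < e / 2 :> R)%R.
    by have /ltr_add_invr[m] := divr_gt0 e0 (ltr0n R 2); rewrite add0r; exists m.
  have m0 : (0 < m.+1%:R^-1 / 2 :> R)%R by rewrite divr_gt0// invr_gt0.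
  have [d [dx Dd]] : exists d, (ball x (m.+1%:R^-1 / 2)%R)^° d /\ D d.
    have [|d [? ?]] := denseD (ball x (m.+1%:R^-1 / 2)%R)^° _ (@open_interior _ _).
      by exists x; exact: nbhsx_ballx.
    by exists d.
  have gd : g (f d) = d.
    rewrite /g; case: xgetP => [z _ [Dz fz]|/(_ d)[]//].
    by apply: injf; rewrite ?inE.
  exists (f d) => //; exists m => //; rewrite /O gd; split=> /=.
    apply: (@filterS _ _ _ (ball x (m.+1%:R^-1 / 2)%R)); last exact: nbhsx_ballx.
    move=> z xz; apply: ball_splitr (xz); apply: interior_subset.
    by [].
  move=> /interior_subset dy.
  have yU : U y.
    apply: xeU; apply: (@le_ball _ _ _ (m.+1%:R^-1 + m.+1%:R^-1)%R).
      by rewrite [leRHS]splitr; apply: lerD; exact: ltW.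
    apply: ball_triangle dy; apply: (@le_ball _ _ _ (m.+1%:R^-1 / 2)%R).
      by rewrite ler_pdivrMr// ler_peMr ?invr_ge0// ler1n.
    exact: interior_subset.
  by move/eqP/seteqP : UV0 => [+ _] => /(_ y); apply.
apply: bigcup_measurable => n _; apply: bigcup_measurable => m _.
by apply: measurableX => //; exact: measurableC.
Qed.

End diagonal.

Lemma measurable_point d (T : measurableType d) :
  measurable [set z : T * T | z.1 = z.2] -> forall x : T, measurable [set x].
Proof.
move=> mdiag x; rewrite (_ : [set x] = xsection [set z : T * T | z.1 = z.2] x).
  exact: measurable_xsection.
by apply/seteqP; split=> y /=; [move=> ->; apply/xsectionP|move=> /xsectionP].
Qed.

(** * Jump rates as the positive part of the transition rates *)

Section rate_charge.
Context d (T : measurableType d) (R : realType).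
Variables (nu : {charge set T -> \bar R}) (x : T).
Hypothesis mx : measurable [set x].
Hypothesis nu_ge0 : forall D, measurable D -> ~ D x -> 0 <= nu D.
Hypothesis nuT : nu setT = 0.

Lemma rate_pointE : nu [set x] = - nu (~` [set x]).
Proof.
have fin : nu (~` [set x]) \is a fin_num by apply: fin_num_measure; exact: measurableC.
have h : nu [set x] + nu (~` [set x]) = 0.
  by rewrite addeC -nuT (chargeDI nu measurableT mx) setTD setTI.
by rewrite -(addeK (nu [set x]) fin) h add0e.
Qed.

Let rate_point_le0 : nu [set x] <= 0.
Proof.
rewrite rate_pointE oppe_le0; apply: nu_ge0; first exact: measurableC.
by move=> /(_ erefl).
Qed.

Variables (P N : set T) (PN : hahn_decomposition nu P N).

Let mP : measurable P. Proof. by case: PN => -[]. Qed.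
Let mN : measurable N. Proof. by case: PN => _ []. Qed.

Let rate_point_P : P x -> nu [set x] = 0.
Proof.
move=> Px; apply/eqP; rewrite eq_le rate_point_le0/=.
by case: PN => -[_ posP] _ _ _; apply: posP => // _ ->.
Qed.

Let rate_point_subset D : D `<=` P -> nu (D `&` [set x]) = 0.
Proof.
move=> DP; have [Dx|nDx] := pselect (D x).
  rewrite (_ : _ `&` _ = [set x]); first exact: rate_point_P (DP _ Dx).
  by apply/seteqP; split=> y /= => [[]//|->].
rewrite (_ : _ `&` _ = set0) ?charge0//.
by apply/seteqP; split=> y //= -[Dy yx]; apply: nDx; rewrite -yx.
Qed.

Let rate_off_point D : measurable D -> nu ((D `\ x) `&` N) = 0.
Proof.
move=> mD; have mDx : measurable ((D `\ x) `&` N).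
  by apply: measurableI => //; exact: measurableD.
apply/eqP; rewrite eq_le nu_ge0 ?andbT//; last by move=> [[_ /=]].
by case: PN => _ [_ negN] _ _; apply: negN => // y [].
Qed.

(** A charge that is nonnegative off [x] and of total mass 0 is the restriction
    to the complement of [x], minus a multiple of the Dirac mass at [x]; these
    two parts are mutually singular, hence are the Jordan decomposition up to
    the null differences in the choice of a Hahn decomposition. *)
Lemma jordan_pos_rate D : measurable D -> jordan_pos PN D = nu (D `\ x).
Proof.
move=> mD; have mDx : measurable (D `\ x) by exact: measurableD.
rewrite jordan_posE cjordan_posE /crestr0 mem_set// /crestr.
case: (PN) => _ _ PNT PN0.
rewrite (charge_partition nu mDx mP mN PNT PN0) rate_off_point// adde0.
rewrite (chargeDI nu (measurableI _ _ mD mP) mx) rate_point_subset// adde0.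
by congr (nu _); rewrite !setDE setIAC.
Qed.

Lemma jordan_neg_rate D : measurable D ->
  jordan_neg PN D = nu (~` [set x]) * \d_x D.
Proof.
move=> mD.
rewrite jordan_negE cjordan_negE /crestr0 mem_set// /crestr.
rewrite (chargeDI nu (measurableI _ _ mD mN) mx).
rewrite (_ : (D `&` N) `\ x = (D `\ x) `&` N); last by rewrite !setDE setIAC.
rewrite rate_off_point// add0e.
case: (PN) => _ _ PNT PN0.
rewrite diracE; have [Dx|nDx] := boolP (x \in D); last first.
  rewrite mule0 (_ : _ `&` _ = set0) ?charge0 ?oppe0//.
  apply/seteqP; split=> y //= -[[Dy _] yx].
  by move: nDx; rewrite -yx notin_setE.
rewrite mule1; have [Nx|nNx] := pselect (N x).
  rewrite (_ : _ `&` _ = [set x]) ?rate_pointE ?oppeK//.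
  by apply/seteqP; split=> y /= => [[]//|->]; rewrite inE in Dx.
rewrite (_ : _ `&` _ = set0); last first.
  by apply/seteqP; split=> y //= -[[_ Ny] yx]; apply: nNx; rewrite -yx.
rewrite charge0 oppe0 -[RHS]oppeK -rate_pointE rate_point_P ?oppe0//.
have : [set: T] x by [].
by rewrite -PNT => -[].
Qed.

Lemma integral_jordan_neg_rate (u : T -> \bar R) : nnmeasurable u ->
  \int[jordan_neg PN]_y u y = nu (~` [set x]) * u x.
Proof.
move=> [mu u0].
have mC : measurable (~` [set x]) by exact: measurableC.
have n0 : (0 <= fine (nu (~` [set x])))%R.
  by apply: fine_ge0; apply: nu_ge0 => // /(_ erefl).
rewrite (eq_measure_integral (mscale (NngNum n0) (dirac x))); last first.
  move=> D mD _; apply: etrans (jordan_neg_rate mD) _.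
  transitivity ((fine (nu (~` [set x])))%:E * \d_x D) => //.
  by rewrite fineK//; exact: fin_num_measure.
rewrite ge0_integral_mscale//= integral_dirac// diracT mul1e fineK//.
exact: fin_num_measure.
Qed.

End rate_charge.

Section jump_rates.
Context dS (S : measurableType dS) dA (A : measurableType dA) (R : realType).
Variables (adm : S -> set A) (q : S -> A -> {charge set S -> \bar R}).
Hypothesis mK : measurable (adm_graph adm).
Hypothesis rates : transition_rates adm q.
Hypothesis mdiag : measurable [set z : S * S | z.1 = z.2].

(** The measurability of q(D | x, a) in (x, a) is given for fixed D; the jump
    rates need D `\ x, which moves with x. Sections of a product set form a
    Dynkin system containing the rectangles. *)
Lemma measurable_rate_section (C : set (S * S)) : measurable C ->
  measurable_fun (adm_graph adm) (fun z : S * A => q z.1 z.2 (xsection C z.1)).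
Proof.
have [mq _ qT _] := rates.
pose G := [set B `*` D | B in @measurable _ S & D in @measurable _ S].
have mG : @measurable _ (S * S)%type = <<s G>> by exact: measurable_prod_measurableType.
rewrite {1}mG; move: C; apply: (@dynkin_induction _ _ G (fun C =>
  measurable_fun (adm_graph adm) (fun z : S * A => q z.1 z.2 (xsection C z.1)))) => //.
- move=> _ _ [X1 mX1 [X2 mX2 <-]] [Y1 mY1 [Y2 mY2 <-]].
  exists (X1 `&` Y1); first exact: measurableI.
  by exists (X2 `&` Y2); [exact: measurableI|rewrite setXI].
- under eq_fun do rewrite xsectionE preimage_setT.
  exact: mq.
- move=> _ [B mB [D mD <-]].
  rewrite (_ : (fun z => _) = fun z : S * A => (\1_B z.1)%:E * q z.1 z.2 D).
    apply: emeasurable_funM; last exact: mq.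
    apply/measurable_EFinP; apply: measurable_funTS.
    exact: measurableT_comp.
  apply/funext => z; rewrite indicE.
  have [zB|zB] := boolP (z.1 \in B); first by rewrite in_xsectionX// mul1e.
  by rewrite notin_xsectionX// mul0e charge0.
- move=> C mC ih.
  apply: (eq_measurable_fun (fun z : S * A => - q z.1 z.2 (xsection C z.1))).
    move=> [x a] /[!inE]/= xa.
    have mCx : measurable (xsection C x) by exact: measurable_xsection.
    have fin : q x a (xsection C x) \is a fin_num by exact: fin_num_measure.
    have := chargeDI (q x a) measurableT mCx; rewrite setTI setTD qT// => h.
    rewrite (_ : xsection (~` C) x = ~` xsection C x); last by rewrite !xsectionE.
    by rewrite -(addeK (q x a (~` xsection C x)) fin) -h add0e.
  exact: measurableT_comp.
- move=> F mF tF ih.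
  apply: (@emeasurable_fun_cvg _ _ _ _ (fun n (z : S * A) =>
    \sum_(0 <= i < n) q z.1 z.2 (xsection (F i) z.1))).
    by move=> n; apply: emeasurable_sum.
  move=> [x a] /= xa; rewrite xsection_bigcup.
  apply: charge_semi_sigma_additive.
  + by move=> i; exact: measurable_xsection.
  + exact: trivIset_xsection.
  + by apply: bigcup_measurable => i _; exact: measurable_xsection.
Qed.

Definition hahn_pair (nu : {charge set S -> \bar R}) :=
  projT2 (cid (projT2 (cid (Hahn_decomposition nu)))).

(** On the graph this is q(D `\ x | x, a) as a measure in D; it is made zero
    elsewhere, so that it is a kernel on the whole product space. *)
Definition jump_rate (z : S * A) : {measure set S -> \bar R} :=
  if z \in adm_graph adm
  then (jordan_pos (hahn_pair (q z.1 z.2)) : {measure set S -> \bar R}) else mzero.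

Lemma jump_rateE x a D : adm x a -> measurable D ->
  jump_rate (x, a) D = q x a (D `\ x).
Proof.
have [_ q0 qT _] := rates; move=> xa mD.
rewrite /jump_rate mem_set//=; apply: jordan_pos_rate => //.
- exact: measurable_point.
- by move=> *; exact: q0.
- exact: qT.
Qed.

Lemma measurable_jump_rate D : measurable D ->
  measurable_fun setT (fun z => jump_rate z D).
Proof.
move=> mD; pose C := [set z : S * S | D z.2] `\` [set z | z.1 = z.2].
have mC : measurable C.
  apply: measurableD => //; rewrite -[X in measurable X]setTI.
  exact: measurable_snd.
rewrite (_ : (fun z => _) = (fun z => if z \in adm_graph adm then
    q z.1 z.2 (xsection C z.1) else 0)); last first.
  apply/funext => -[x a] /=; case: ifPn => [/[!inE] xa|nxa].
    rewrite jump_rateE//; congr (q x a _).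
    by apply/seteqP; split=> y; rewrite xsectionE /C /= => -[Dy]; split=> // /esym.
  by rewrite /jump_rate (negbTE nxa).
apply: measurable_fun_if_mem => //.
exact: measurable_rate_section.
Qed.

Lemma measurable_jump_rate_integral (u : S -> \bar R) : nnmeasurable u ->
  measurable_fun setT (fun z => \int[jump_rate z]_y u y).
Proof.
move=> [mu u0]; apply: measurable_fun_integral_kernel => // D mD.
exact: measurable_jump_rate.
Qed.

Lemma jump_rate_bound x : exists2 C : R, (0 <= C)%R &
  forall a, adm x a -> jump_rate (x, a) setT <= C%:E.
Proof.
have [_ q0 qT qsup] := rates.
have mx := measurable_point mdiag x.
have B a : adm x a -> jump_rate (x, a) setT <= `|q x a [set x]|.
  move=> xa; rewrite jump_rateE// setTD.
  rewrite (@rate_pointE _ _ _ _ _ mx (qT _ _ xa)) abseN.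
  exact: lee_abs.
pose s := ereal_sup [set `|q x a [set x]| | a in adm x].
exists (Num.max (fine s) 0%R); first by rewrite le_max lexx orbT.
move=> a xa; have qs : `|q x a [set x]| <= s by apply: ereal_sup_ubound; exists a.
have sfin : s \is a fin_num.
  rewrite ge0_fin_numE; first exact: qsup.
  exact: le_trans qs.
apply: le_trans (B _ xa) _; apply: le_trans qs _.
by rewrite -(fineK sfin) lee_fin le_max lexx.
Qed.

(** The integral against q is the integral against the jump rates minus the
    total jump rate times the value at the current state; the latter is
    finite, so it can change sides. *)
Lemma jump_rate_drift x a (u : S -> \bar R) (c : R) : adm x a ->
  nnmeasurable u -> u x < +oo -> charge_integral (q x a) u <= c%:E ->
  \int[jump_rate (x, a)]_y u y <= c%:E + jump_rate (x, a) setT * u x.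
Proof.
have [_ q0 qT _] := rates; move=> xa mu ux.
have mx := measurable_point mdiag x.
rewrite /charge_integral (@integral_jordan_neg_rate _ _ _ (q x a) x)//; last 2 first.
- by move=> *; exact: q0.
- exact: qT.
rewrite jump_rateE// setTD /jump_rate mem_set//= => h.
rewrite -leeBlDr//.
rewrite fin_numM// ?fin_num_measure//; first exact: measurableC.
by rewrite ge0_fin_numE// mu.2.
Qed.

End jump_rates.

(** * Intensity of the next jump *)

Section hazard.
Context dS (S : measurableType dS) dA (A : measurableType dA) (R : realType).
Variables (adm : S -> set A) (q : S -> A -> {charge set S -> \bar R}).
Hypothesis madm : forall x, measurable (adm x).
Hypothesis mK : measurable (adm_graph adm).
Hypothesis rates : transition_rates adm q.
Hypothesis mdiag : measurable [set z : S * S | z.1 = z.2].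
Variable pi : R.-pker (predictable S R) ~> (option A).
Hypothesis pi_policy : policy adm pi.
Local Notation Om := (Omega S R).

Lemma policy_conull (e : Om) (t : R) (y : S) :
  (0 <= t)%R -> xi_left e t = Some y ->
  pi (e, to_time t) (Some @` adm y) = 1 /\
  pi (e, to_time t) (~` (Some @` adm y)) = 0.
Proof.
move=> t0 ey; have mN : measurable (Some @` adm y) by exact: measurable_image_Some.
have pN : pi (e, to_time t) (Some @` adm y) = 1.
  by have := pi_policy e (to_time t); rewrite /= ger0_norm// ey.
split=> //.
have : pi (e, to_time t) setT = pi (e, to_time t) (Some @` adm y) +
    pi (e, to_time t) (~` (Some @` adm y)).
  by rewrite -measureU ?setICr// ?setUv//; exact: measurableC.
rewrite prob_kernel pN.
by move/(congr1 (fun z => z - 1)); rewrite [RHS]addeAC subee// add0e.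
Qed.

Lemma measurable_range_Some : measurable (range (@Some A)).
Proof. exact: measurable_image_Some. Qed.

(** This is the integral of [u] against the intensity [z.2] time units after
    the [k]-th jump of [z.1]. Reading the policy along the stopped path makes
    it depend on the history only, and jointly measurable. *)
Definition hazard k (u : S -> \bar R) (z : Om * R) : \bar R :=
  \int[pi (after_jump k z)]_(a in range Some)
    \int[jump_rate adm q
      (odflt point (path_state z.1 k), odflt point a)]_y u y.

Lemma measurable_hazard_integrand u : nnmeasurable u ->
  measurable_fun setT (fun z : option S * option A =>
    \int[jump_rate adm q (odflt point z.1, odflt point z.2)]_y u y).
Proof.
move=> mu; apply: (@measurableT_comp _ _ _ _ _ _
  (fun z => \int[jump_rate adm q z]_y u y) _
  (fun z : option S * option A => (odflt point z.1, odflt point z.2))).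
  exact: measurable_jump_rate_integral.
apply: measurable_fun_pair.
  exact: measurableT_comp (measurable_odflt _) measurable_fst.
exact: measurableT_comp (measurable_odflt _) measurable_snd.
Qed.

Lemma nnmeasurable_hazard k u : nnmeasurable u -> nnmeasurable (hazard k u).
Proof.
move=> mu; split; last first.
  move=> z; apply: integral_ge0 => a _; apply: integral_ge0 => y _; exact: mu.2.
rewrite /hazard; under eq_fun do rewrite integral_mkcond.
pose f (z : (Om * R) * option A) : \bar R := if z.2 \in range Some then
  \int[jump_rate adm q (odflt point (path_state z.1.1 k), odflt point z.2)]_y u y
  else 0.
rewrite (_ : (fun z => _) = fun z => \int[pi (after_jump k z)]_a f (z, a)); last first.
  by apply/funext => z; apply: eq_integral => a _; rewrite patchE /f.
(* the masses are 1 and the bound is strict, whence 2 *)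
apply: (@measurable_fun_integral_bounded _ _ _ _ _
  (fun z => pi (after_jump k z)) 2%R).
- move=> U mU.
  exact: (measurableT_comp (measurable_kernel pi U mU) (measurable_after_jump k)).
- by move=> z; rewrite prob_kernel lte_fin ltr1n.
- split; last first.
    by move=> z; rewrite /f; case: ifP => // _; apply: integral_ge0 => y _; exact: mu.2.
  have mS : measurable (snd @^-1` (range (@Some A)) : set ((Om * R) * option A)).
    rewrite -[X in measurable X]setTI.
    by apply: measurable_snd => //; exact: measurable_range_Some.
  rewrite /f; apply: (@measurable_fun_if_mem _ _ _ _ _
    (fun z : (Om * R) * option A => \int[jump_rate adm q
      (odflt point (path_state z.1.1 k), odflt point z.2)]_y u y) (cst 0) mS).
  + apply: measurable_funTS.
    apply: (@measurableT_comp _ _ _ _ _ _ _ _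
      (fun z : (Om * R) * option A => (path_state z.1.1 k, z.2))
      (measurable_hazard_integrand mu)).
    apply: measurable_fun_pair => //.
    apply: (measurableT_comp (measurable_path_state k)).
    exact: measurableT_comp.
  + exact: measurable_cst.
Qed.

Lemma sigma_linear_hazard k z : sigma_linear (fun u => hazard k u z).
Proof.
apply: sigma_linear_int; first exact: measurable_range_Some.
  by move=> a _; exact: sigma_linear_integral.
move=> u mu; apply: measurable_funTS.
exact: (measurable_fun_pair2 (path_state z.1 k) (measurable_hazard_integrand mu)).
Qed.

Section after_kth_jump.
Variables (k : nat) (e : Om) (x : S) (t : R).
Hypothesis ex : path_state e k = Some x.
Hypothesis t0 : (0 < t)%R.

Let alive_e : path_state e k <> None. Proof. by rewrite ex. Qed.

Let time_ge0 : (0 <= fine (jump_time e k) + t)%R.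
Proof. by rewrite addr_ge0// ?(ltW t0)// fine_ge0// jump_time_ge0. Qed.

Let xi_left_after : xi_left (stop_path k e) (fine (jump_time e k) + t)%R = Some x.
Proof. by rewrite (xi_leftE (xi_left_stop_path alive_e t0)) stop_path_state. Qed.

Let policy_after_jump : pi (after_jump k (e, t)) (Some @` adm x) = 1.
Proof. exact: (policy_conull time_ge0 xi_left_after).1. Qed.

Let mN : measurable (Some @` adm x). Proof. exact: measurable_image_Some. Qed.

Let conull : pi (after_jump k (e, t)) (~` (Some @` adm x)) = 0.
Proof. exact: (policy_conull time_ge0 xi_left_after).2. Qed.

Let subN : Some @` adm x `<=` range Some.
Proof. by move=> _ [a _ <-]; exists a. Qed.

Lemma hazardE u : nnmeasurable u -> hazard k u (e, t) =
  \int[pi (after_jump k (e, t))]_(a in Some @` adm x)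
    \int[jump_rate adm q (x, odflt point a)]_y u y.
Proof.
move=> mu; rewrite /hazard ex/= (integral_conull mN subN conull)//.
  apply: measurable_funTS.
  exact: (measurable_fun_pair2 (Some x) (measurable_hazard_integrand mu)).
by move=> *; apply: integral_ge0 => y _; exact: mu.2.
Qed.

Let measurable_jump_rate_action D : measurable D ->
  measurable_fun setT (fun a : option A => jump_rate adm q (x, odflt point a) D).
Proof.
move=> mD; apply: (@measurableT_comp _ _ _ _ _ _
  (fun z => jump_rate adm q z D) _ (fun a : option A => (x, odflt point a))).
  exact: measurable_jump_rate.
by apply: measurable_fun_pair => //; exact: measurable_odflt.
Qed.

(** An inequality between rates that holds for each admissible action survives
    averaging over the policy, because the policy has total mass 1 on the
    admissible actions. *)
Lemma hazard_le u (c b : R) : nnmeasurable u -> (0 <= c)%R -> (0 <= b)%R ->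
  (forall a, adm x a -> \int[jump_rate adm q (x, a)]_y u y <=
     c%:E + jump_rate adm q (x, a) setT * b%:E) ->
  hazard k u (e, t) <= c%:E + hazard k (cst 1) (e, t) * b%:E.
Proof.
have mtot := measurable_jump_rate_action measurableT.
move=> mu c0 b0 ub; rewrite (hazardE mu) (hazardE (@nnmeasurable1 _ S R)).
apply: (@le_trans _ _ (\int[pi (after_jump k (e, t))]_(a in Some @` adm x)
    (c%:E + jump_rate adm q (x, odflt point a) setT * b%:E))).
  apply: ge0_le_integral => //.
  - by move=> *; apply: integral_ge0 => y _; exact: mu.2.
  - apply: measurable_funTS.
    exact: (measurable_fun_pair2 (Some x) (measurable_hazard_integrand mu)).
  - apply: measurable_funTS; apply: emeasurable_funD => //.
    exact: emeasurable_funM mtot _.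
  - by move=> _ [a xa <-]; exact: ub.
rewrite ge0_integralD//; last 2 first.
- by move=> *; rewrite mule_ge0.
- by apply: measurable_funTS; exact: emeasurable_funM mtot _.
rewrite integral_cst// policy_after_jump mule1 leeD2l//.
rewrite ge0_integralZr//; last exact: measurable_funTS mtot.
by under [X in _ <= X * _]eq_integral do rewrite integral_cst// mul1e.
Qed.

Lemma hazard_le_cst (C : R) : (0 <= C)%R ->
  (forall a, adm x a -> jump_rate adm q (x, a) setT <= C%:E) ->
  hazard k (cst 1) (e, t) <= C%:E.
Proof.
move=> C0 ub; have m1 := @nnmeasurable1 _ S R.
have := @hazard_le (cst 1) C 0%R m1 C0 (lexx _).
rewrite !mule0 !adde0; apply => a xa; rewrite mule0 adde0.
by rewrite integral_cst// mul1e ub.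
Qed.

(** The stopped path has the same history, so every representation takes at
    that history the value which the intensity has along the stopped path. *)
Lemma representation_hazard (m : forall k, history S R k -> R -> set S -> \bar R)
    (D : set S) : intensity_representation q pi m -> measurable D ->
  m k (hist k e) t D = hazard k (fun y => (\1_D y)%:E) (e, t).
Proof.
move=> mrep mD.
have := mrep k (stop_path k e) (fine (jump_time e k) + t)%R D mD
  (xi_left_stop_path alive_e t0).
rewrite hist_stop_path stop_path_jump_time// addrAC subrr add0r => <-.
rewrite /intensity xi_left_after.
rewrite /at_state/= /action_integral hazardE; last exact: nnmeasurable_indic.
have jE a : (Some @` adm x) a ->
    oapp (fun a => q x a (D `\ x)) 0 a = jump_rate adm q (x, odflt point a) D.
  by move=> [a' xa' <-] /=; rewrite jump_rateE.
rewrite (integral_conull mN subN conull); last 2 first.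
- apply: eq_measurable_fun (measurable_funTS (measurable_jump_rate_action mD)).
  by move=> a /[!inE] /jE.
- by move=> a /jE ->.
apply: eq_integral => a /[!inE] /jE ->.
by rewrite integral_indic// setIT.
Qed.

End after_kth_jump.

Definition survival k (z : Om * R) : \bar R :=
  expeR (- \int[lebesgue_measure]_(v in `]0%R, z.2])
    hazard k (cst 1) (z.1, v)).

Lemma nnmeasurable_survival k : nnmeasurable (survival k).
Proof.
split; last by move=> z; exact: expeR_ge0.
apply: (measurableT_comp (@measurable_expeR R)).
apply: measurableT_comp => //.
pose f (z : (Om * R) * R) : \bar R := if (0 < z.2 <= z.1.2)%R then
  hazard k (cst 1) (z.1.1, z.2) else 0.
have [mh h0] := nnmeasurable_hazard k (@nnmeasurable1 _ S R).
rewrite (_ : (fun z => _) = fun z => \int[lebesgue_measure]_v f (z, v)); last first.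
  apply/funext => z; rewrite integral_mkcond; apply: eq_integral => v _.
  by rewrite patchE /f mem_setE in_itv.
apply: (@measurable_fun_fubini_tonelli_F _ _ _ _ _ (@lebesgue_measure R) f).
  apply: measurable_fun_ifT => //.
    apply: measurable_and; first exact: measurable_fun_ltr.
    by apply: measurable_fun_ler => //; exact: measurableT_comp.
  apply: (measurableT_comp mh (g := fun z : (Om * R) * R => (z.1.1, z.2))).
  by apply: measurable_fun_pair => //; exact: measurableT_comp.
by move=> z; rewrite /f; case: ifP.
Qed.

End hazard.

(** * Joint law of the next sojourn time and the next state *)

Lemma sigma_linear_at_state d (S : measurableType d) (R : realType)
    (x : option S) : sigma_linear (fun u : S -> \bar R => at_state x u).
Proof.
case: x => [x|]; first exact: sigma_linear_eval.
split=> [f _|c f _ _|f _]; rewrite /at_state/= ?mule0//.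
by rewrite eseries0.
Qed.

Lemma nnmeasurable_integral_pos d (T : measurableType d) (R : realType)
    (g : T * R -> \bar R) : nnmeasurable g ->
  nnmeasurable (fun x => \int[lebesgue_measure]_(t in `]0%R, +oo[) g (x, t)).
Proof.
move=> [mg g0]; split; last by move=> x; exact: integral_ge0.
pose f (z : T * R) : \bar R := if (0 < z.2)%R then g z else 0.
rewrite (_ : (fun x => _) = fun x => \int[lebesgue_measure]_t f (x, t)).
  apply: (@measurable_fun_fubini_tonelli_F _ _ _ _ _ (@lebesgue_measure R) f).
    by apply: measurable_fun_ifT => //; exact: measurable_fun_ltr.
  by move=> z; rewrite /f; case: ifP.
apply/funext => x; rewrite integral_mkcond; apply: eq_integral => t _.
by rewrite patchE /f mem_setE in_itv/= andbT.
Qed.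

Section law.
Context dS (S : measurableType dS) dA (A : measurableType dA) (R : realType).
Variables (adm : S -> set A) (q : S -> A -> {charge set S -> \bar R}).
Hypothesis madm : forall x, measurable (adm x).
Hypothesis mK : measurable (adm_graph adm).
Hypothesis rates : transition_rates adm q.
Hypothesis mdiag : measurable [set z : S * S | z.1 = z.2].
Variable pi : R.-pker (predictable S R) ~> (option A).
Hypothesis pi_policy : policy adm pi.
Local Notation Om := (Omega S R).
Variable gamma : {measure set S -> \bar R}.
Variable P : probability Om R.
Hypothesis Plaw : strategic_measure q pi gamma P.

Lemma initial_law (u : S -> \bar R) : nnmeasurable u ->
  \int[P]_e at_state (path_state e 0) u = \int[gamma]_x u x.
Proof.
move: u; apply: sigma_linear_ext.
- apply: sigma_linear_int => // [e _|u]; first exact: sigma_linear_at_state.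
  exact: measurable_at_path_state.
- exact: sigma_linear_integral.
move=> D mD; rewrite integral_indic// setIT -(Plaw.1 _ mD).
rewrite -[X in _ = P X]setIT -integral_indic//; last first.
  rewrite -[X in measurable X]setTI.
  by apply: (measurable_path_state 0) => //; exact: measurable_image_Some.
apply: eq_integral => e _; rewrite indicE.
case ex : (path_state e 0) => [y|]; rewrite /at_state/= ?indicE.
  congr ((nat_of_bool _)%:R%:E); apply/idP/idP => /set_mem h;
    apply/mem_set => /=; rewrite ?ex.
    by exists y.
  by move: h; rewrite /= ex => -[y' ? [<-]].
by rewrite memNset// /= ex => -[].
Qed.

Let haz := hazard adm q pi.
Let surv := survival adm q pi.

Let nn_haz k u : nnmeasurable u -> nnmeasurable (haz k u).
Proof. exact: nnmeasurable_hazard. Qed.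

Let nn_surv k : nnmeasurable (surv k).
Proof. exact: nnmeasurable_survival. Qed.

(** The prescribed law, for the sojourn times restricted to positive numbers
    and with the representation of the intensity replaced by [hazard]. *)
Lemma next_jump_law_rectangle k (H : set (history S R k)) (G : set R) (D : set S) :
  measurable H -> measurable G -> measurable D ->
  \int[P]_(e in alive k) ((\1_H (hist k e))%:E *
    (\1_G (fine (path_sojourn e k)))%:E *
    at_state (path_state e k.+1) (fun y => (\1_D y)%:E)) =
  \int[P]_(e in alive k) \int[lebesgue_measure]_(t in `]0%R, +oo[)
    ((\1_H (hist k e))%:E * (\1_G t)%:E *
     (haz k (fun y => (\1_D y)%:E) (e, t) * surv k (e, t))).
Proof.
move=> mH mG mD; have [_ [m mrep mlaw]] := Plaw.
pose G' := `]0%R, +oo[%classic `&` G.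
have mG' : measurable G' by exact: measurableI.
have [lawG _] := mlaw _ H mH.
have G'0 : G' `<=` [set t : R | (0 < t)%R].
  by move=> t [/=]; rewrite in_itv/= andbT.
have := lawG G' D mG' G'0 mD.
set E := [set e | _ /\ _]; set B := [set e | _ /\ _] => lawE.
have EE : E = alive k `&` (hist k @^-1` H).
  by apply/seteqP; split=> e [].
have mhist : measurable (hist k @^-1` H : set Om).
  by rewrite -[X in measurable X]setTI; exact: measurable_hist.
transitivity (P (E `&` B)).
  have mB : measurable (B : set Om).
    rewrite (_ : B = ((fun e : Om => path_sojourn e k) @^-1` (EFin @` G')) `&`
      ((fun e : Om => path_state e k.+1) @^-1` (Some @` D)))//.
    apply: measurableI; rewrite -[X in measurable X]setTI.
      by apply: measurable_path_sojourn => //; exact: measurable_image_EFin.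
    by apply: measurable_path_state => //; exact: measurable_image_Some.
  rewrite EE -setIA setIC -integral_indic//; last 2 first.
    exact: measurable_alive.
    exact: measurableI.
  apply: eq_integral => e /[!inE] ek.
  rewrite /alive/= in ek.
  case ex : (path_state e k.+1) => [y|]; last first.
    rewrite /at_state/= mule0 indicE memNset// => -[_ [_ /=]].
    by rewrite ex => -[].
  have sfin : path_sojourn e k \is a fin_num.
    rewrite ge0_fin_numE; last exact/ltW/path_sojourn_gt0.
    by apply/path_sojourn_finP; rewrite ex.
  have s0 : (0 < fine (path_sojourn e k))%R.
    by rewrite -lte_fin fineK// path_sojourn_gt0.
  rewrite /at_state/= -!EFinM !indicE -!natrM !mulnb; congr ((nat_of_bool _)%:R%:E).
  apply/idP/idP.
    move=> /andP[/andP[/set_mem h1 /set_mem h2] /set_mem h3].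
    apply/mem_set; split => //.
    split=> /=; last by rewrite ex; exists y.
    exists (fine (path_sojourn e k)); last by rewrite fineK.
    by split=> //=; rewrite in_itv/= s0.
  move=> /set_mem[h1 [/= [t [_ Gt] <-]]]; rewrite ex => -[y' Dy' [<-]].
  by rewrite !mem_set.
rewrite lawE EE integral_mkcondr; apply: eq_integral => e /[!inE] ek.
rewrite patchE; case: ifPn => he; last first.
  have -> : \1_H (hist k e) = 0%R :> R.
    by rewrite indicE memNset//; move: he; rewrite notin_setE.
  by rewrite integral0_eq// => t _; rewrite !mul0e.
have -> : \1_H (hist k e) = 1%R :> R by rewrite indicE mem_set//; move: he; rewrite inE.
rewrite integral_mkcondr; apply: eq_integral => t; rewrite mem_setE in_itv/= andbT => t0.
rewrite mul1e patchE indicE; case: ifPn => tG; last by rewrite mul0e.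
rewrite mul1e.
case ex : (path_state e k) => [x|]; last by case: ek.
rewrite (representation_hazard madm mK rates mdiag pi_policy ex t0 mrep mD).
congr (_ * _); rewrite /surv /survival/=; congr (expeR (- _)).
apply: eq_integral => v; rewrite mem_setE in_itv/= => /andP[v0 _].
rewrite (representation_hazard madm mK rates mdiag pi_policy ex v0 mrep measurableT).
by congr (hazard _ _ _ _ _ _); apply/funext => y; rewrite indicT.
Qed.

(** Both sides are sigma-linear in [f] and in [u]. They agree on indicators, so
    they agree in [u] for the indicator of a rectangle in place of [f], and
    then in [f]. The left side is at most 1 at indicators, which supplies the
    finiteness that the extension from rectangles requires. *)
Lemma next_jump_law k (f : history S R k * R -> \bar R) (u : S -> \bar R) :
  nnmeasurable f -> nnmeasurable u ->
  \int[P]_(e in alive k) (f (hist k e, fine (path_sojourn e k)) *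
    at_state (path_state e k.+1) u) =
  \int[P]_(e in alive k) \int[lebesgue_measure]_(t in `]0%R, +oo[)
    (f (hist k e, t) * (haz k u (e, t) * surv k (e, t))).
Proof.
move=> mf mu; pose L := (@lebesgue_measure R).
have mal : measurable (alive k : set Om) by exact: measurable_alive.
pose Phi1 (f : history S R k * R -> \bar R) (u : S -> \bar R) :=
  \int[P]_(e in alive k) (f (hist k e, fine (path_sojourn e k)) *
    at_state (path_state e k.+1) u).
pose Phi2 (f : history S R k * R -> \bar R) (u : S -> \bar R) :=
  \int[P]_(e in alive k) \int[L]_(t in `]0%R, +oo[)
    (f (hist k e, t) * (haz k u (e, t) * surv k (e, t))).
rewrite -/(Phi1 f u) -/(Phi2 f u).
have mPsi1 (g : history S R k * R -> \bar R) (v : S -> \bar R) :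
    nnmeasurable g -> nnmeasurable v -> measurable_fun (alive k)
    (fun e : Om => g (hist k e, fine (path_sojourn e k)) *
      at_state (path_state e k.+1) v).
  move=> mg mv; apply: measurable_funTS; apply: emeasurable_funM.
    exact: (measurable_hist_sojourn mg).
  exact: (measurable_at_path_state k.+1 mv).
have nnprod (g : history S R k * R -> \bar R) (v : S -> \bar R) :
    nnmeasurable g -> nnmeasurable v -> nnmeasurable
    (fun z : Om * R => g (hist k z.1, z.2) * (haz k v z * surv k z)).
  move=> mg mv; apply: nnmeasurableM; first exact: (nnmeasurable_hist mg).
  by apply: nnmeasurableM; [exact: nn_haz|exact: nn_surv].
have mPsi2 (g : history S R k * R -> \bar R) (v : S -> \bar R) :
    nnmeasurable g -> nnmeasurable v -> measurable_fun (alive k)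
    (fun e : Om => \int[L]_(t in `]0%R, +oo[)
       (g (hist k e, t) * (haz k v (e, t) * surv k (e, t)))).
  move=> mg mv; apply: measurable_funTS.
  exact: (nnmeasurable_integral_pos (nnprod _ _ mg mv)).1.
have mslice (g : history S R k * R -> \bar R) (v : S -> \bar R) (e : Om) :
    nnmeasurable g -> nnmeasurable v ->
    measurable_fun (`]0%R, +oo[%classic : set R) (fun t : R =>
      g (hist k e, t) * (haz k v (e, t) * surv k (e, t))).
  move=> mg mv; apply: measurable_funTS.
  exact: (measurable_fun_pair2 (e : Om) (nnprod _ _ mg mv).1).
have L1f v : nnmeasurable v -> sigma_linear (Phi1 ^~ v).
  move=> mv; apply: sigma_linear_int => // [e _|g mg]; last exact: mPsi1.
  under eq_fun do rewrite muleC.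
  apply: sigma_linearM; first exact: at_state_ge0 mv.2.
  exact: sigma_linear_eval.
have L1u g : nnmeasurable g -> sigma_linear (Phi1 g).
  move=> mg; apply: sigma_linear_int => // [e _|v mv]; last exact: mPsi1.
  by apply: sigma_linearM; [exact: mg.2|exact: sigma_linear_at_state].
have L2f v : nnmeasurable v -> sigma_linear (Phi2 ^~ v).
  move=> mv; apply: sigma_linear_int => // [e _|g mg]; last exact: mPsi2.
  apply: sigma_linear_int => // [t _|g mg]; last exact: mslice.
  under eq_fun do rewrite muleC.
  apply: sigma_linearM; last exact: sigma_linear_eval.
  by rewrite mule_ge0//; [exact: (nn_haz k mv).2|exact: (nn_surv k).2].
have L2u g : nnmeasurable g -> sigma_linear (Phi2 g).
  move=> mg; apply: sigma_linear_int => // [e _|v mv]; last exact: mPsi2.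
  apply: sigma_linear_int => // [t _|v mv]; last exact: mslice.
  apply: sigma_linearM; first exact: mg.2.
  under eq_fun do rewrite muleC.
  apply: sigma_linearM; first exact: (nn_surv k).2.
  exact: sigma_linear_hazard.
apply: (sigma_linear_ext (L1u _ mf) (L2u _ mf)) mu => D mD.
have mDi := nnmeasurable_indic R mD.
apply: (sigma_linear_ext_prod (L1f _ mDi) (L2f _ mDi)) mf.
- apply: (@le_lt_trans _ _ (\int[P]_(e in alive k) cst 1 e)); last first.
    by rewrite integral_cst// mul1e (le_lt_trans (probability_le1 _ _))// ltry.
  apply: ge0_le_integral => //.
  + by move=> e _; rewrite mul1e; exact: at_state_ge0 mDi.2.
  + by apply: (mPsi1 (cst 1)) => //; exact: nnmeasurable1.
  + move=> e _; rewrite mul1e; case: (path_state e k.+1) => [y|]/=; last exact: lee01.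
    by rewrite /at_state/= lee_fin indicE; case: (_ \in _).
- move=> H G mH mG; exact: next_jump_law_rectangle.
Qed.

End law.

(** * Mass of a density given by its hazard rate *)

Lemma expRN_le_taylor2 (R : realType) (x : R) : (0 <= x)%R ->
  (expR (- x) <= 1 - x + x ^+ 2)%R.
Proof.
move=> x0; have e0 := expR_gt0 x.
rewrite expRN -[leLHS]mul1r ler_pdivrMr//.
have x1 : (0 <= 1 - x + x ^+ 2)%R by nra.
apply: le_trans (ler_wpM2l x1 (expR_ge1Dx x)).
by have -> : ((1 - x + x ^+ 2) * (1 + x) = 1 + x ^+ 3)%R by [ring];
   rewrite lerDl exprn_ge0.
Qed.

(** The integral of beta(t) exp(- int_0^t beta) is at most 1. Its integrand is
    minus the derivative of the exponential only almost everywhere, as beta is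
    merely measurable. Instead of differentiating, ]0, T] is cut into n equal
    pieces: with D the increment of int beta over one piece, the integral over
    the piece is at most D times the value of the exponential at its left end,
    which exceeds the decrease of the exponential by at most D ^ 2. As
    D <= C T / n, the errors add up to at most (C T) ^ 2 / n. *)
Section survival_integral.
Context (R : realType) (beta : R -> \bar R) (C : R).
Local Notation leb := (@lebesgue_measure R).
Local Notation pos := (`]0%R, +oo[%classic : set R).
Hypothesis mbeta : measurable_fun pos beta.
Hypothesis C_ge0 : (0 <= C)%R.
Hypothesis beta_ge0 : forall t : R, (0 < t)%R -> 0 <= beta t.
Hypothesis beta_le : forall t : R, (0 < t)%R -> beta t <= C%:E.

Let cumul (t : R) := \int[leb]_(v in `]0%R, t]) beta v.
Let decay (t : R) := expeR (- cumul t).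
Hypothesis mdecay : measurable_fun pos decay.

Let sub_pos (s t : R) : (0 <= s)%R -> `]s, t] `<=` pos.
Proof.
move=> s0 v /=; rewrite !in_itv/= andbT => /andP[sv _].
exact: le_lt_trans sv.
Qed.

Let mbetaS (s t : R) : (0 <= s)%R -> measurable_fun (`]s, t]%classic : set R) beta.
Proof. by move=> s0; apply: measurable_funS mbeta => //; exact: sub_pos. Qed.

Let incr_le (s t : R) : (0 <= s <= t)%R ->
  \int[leb]_(v in `]s, t]) beta v <= (C * (t - s))%:E.
Proof.
move=> /andP[s0 st]; apply: (@le_trans _ _ (\int[leb]_(v in `]s, t]) C%:E)).
  apply: ge0_le_integral => //.
  - by move=> v /(sub_pos s0)/=; rewrite in_itv/= andbT; exact: beta_ge0.
  - exact: mbetaS.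
  - by move=> v /(sub_pos s0)/=; rewrite in_itv/= andbT; exact: beta_le.
rewrite integral_cst//= lebesgue_measure_itv/= lte_fin.
case: ifPn => _; first by rewrite -EFinB -EFinM.
by rewrite mule0 lee_fin mulr_ge0// subr_ge0.
Qed.

Let incr_ge0 (s t : R) : (0 <= s)%R -> 0 <= \int[leb]_(v in `]s, t]) beta v.
Proof.
move=> s0; apply: integral_ge0 => v /(sub_pos s0)/=; rewrite in_itv/= andbT.
exact: beta_ge0.
Qed.

Let incr_fin (s t : R) : (0 <= s <= t)%R ->
  \int[leb]_(v in `]s, t]) beta v \is a fin_num.
Proof.
move=> st; rewrite ge0_fin_numE ?(le_lt_trans (incr_le st))// ?ltry//.
by apply: incr_ge0; case/andP: st.
Qed.

Let integral_splitD (f : R -> \bar R) (s t : R) : measurable_fun pos f ->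
  (forall v, (0 < v)%R -> 0 <= f v) -> (0 <= s <= t)%R ->
  \int[leb]_(v in `]0%R, t]) f v =
  \int[leb]_(v in `]0%R, s]) f v + \int[leb]_(v in `]s, t]) f v.
Proof.
move=> mf f0 /andP[s0 st].
have E : (`]0%R, t]%classic : set R) = `]0%R, s]%classic `|` `]s, t]%classic.
  by rewrite -itv_bndbnd_setU// bnd_simp.
rewrite E ge0_integral_setU//.
- by rewrite -E; apply: measurable_funS mf => //; exact: sub_pos.
- by rewrite -E => v /(sub_pos (lexx _))/=; rewrite in_itv/= andbT; exact: f0.
- rewrite disj_set2E; apply/eqP/seteqP; split => // v /=.
  by rewrite !in_itv/= => -[/andP[_ vs] /andP[sv _]]; move: vs; rewrite leNgt sv.
Qed.

Let decay_ge0 t : 0 <= decay t. Proof. exact: expeR_ge0. Qed.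

Let step (s t : R) : (0 <= s <= t)%R ->
  \int[leb]_(v in `]s, t]) (beta v * decay v) + decay t <=
  decay s + ((C * (t - s)) ^+ 2)%:E.
Proof.
move=> st; have /andP[s0 st'] := st.
have s00 : ((0 : R) <= 0 <= s)%R by rewrite lexx s0.
pose D := fine (\int[leb]_(v in `]s, t]) beta v).
pose c := fine (cumul s).
have DE : \int[leb]_(v in `]s, t]) beta v = D%:E by rewrite fineK// incr_fin.
have cE : cumul s = c%:E by rewrite fineK// incr_fin.
clearbody D c.
have D0 : (0 <= D)%R by rewrite -lee_fin -DE incr_ge0.
have DC : (D <= C * (t - s))%R by rewrite -lee_fin -DE incr_le.
have dsE : decay s = (expR (- c))%:E by rewrite /decay cE.
have dtE : decay t = (expR (- c) * expR (- D))%:E.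
  rewrite /decay (_ : cumul t = cumul s + D%:E).
    by rewrite cE -EFinD -EFinN /= opprD expRD.
  by rewrite /cumul (integral_splitD mbeta beta_ge0 st) DE.
have le1 : \int[leb]_(v in `]s, t]) (beta v * decay v) <= (D * expR (- c))%:E.
  rewrite EFinM -DE -dsE -ge0_integralZr; last 4 first.
  - exact: measurable_itv.
  - exact: mbetaS.
  - by move=> v /(sub_pos s0)/=; rewrite in_itv/= andbT; exact: beta_ge0.
  - exact: decay_ge0.
  apply: ge0_le_integral => //.
  - move=> v /(sub_pos s0)/=; rewrite in_itv/= andbT => v0.
    by rewrite mule_ge0// beta_ge0.
  - apply: emeasurable_funM; first exact: mbetaS.
    by apply: measurable_funS mdecay => //; exact: sub_pos.
  - by apply: emeasurable_funM => //; exact: mbetaS.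
  - move=> v vst; have := sub_pos s0 vst; rewrite /= in_itv/= andbT => v0.
    apply: lee_wpmul2l; first exact: beta_ge0.
    rewrite /decay lee_expeR leeN2.
    move: vst; rewrite /= in_itv/= => /andP[sv _].
    have sv' : (0 <= s <= v)%R by rewrite s0 ltW.
    rewrite /cumul (integral_splitD mbeta beta_ge0 sv').
    by rewrite leeDl// incr_ge0.
apply: (@le_trans _ _ ((D * expR (- c)) + expR (- c) * expR (- D))%:E).
  rewrite EFinD -dtE; apply: leeD2r; exact: le1.
rewrite dsE -EFinD lee_fin.
have e1 := expRN_le_taylor2 D0.
have c0 : (0 <= c)%R by rewrite -lee_fin -cE incr_ge0.
have ec1 : (expR (- c) <= 1)%R by rewrite -expR0 ler_expR oppr_le0.
have ec0 := expR_ge0 (- c)%R.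
have := ler_wpM2l ec0 e1.
have DD : (D ^+ 2 <= (C * (t - s)) ^+ 2)%R by rewrite ler_pXn2r// nnegrE (le_trans D0).
have := ler_wpM2r (sqr_ge0 D) ec1.
by move: DD; lra.
Qed.

Let partial (h : R) (n : nat) : (0 <= h)%R ->
  \int[leb]_(v in `]0%R, (h *+ n)%R]) (beta v * decay v) + decay (h *+ n)%R <=
  (1 + ((C * h) ^+ 2) *+ n)%:E.
Proof.
move=> h0; elim: n => [|n ih].
  have -> : (1 + ((C * h) ^+ 2) *+ 0 = 1 :> R)%R by rewrite mulr0n addr0.
  have -> : (h *+ 0 = 0 :> R)%R by [].
  by rewrite /decay /cumul set_itvoc0 !integral_set0 add0e oppe0 expeR0.
have hn : (0 <= h *+ n <= h *+ n.+1)%R.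
  by rewrite mulrn_wge0//= mulrS lerDr.
rewrite (integral_splitD _ _ hn); last 2 first.
- exact: emeasurable_funM.
- by move=> v v0; rewrite mule_ge0// beta_ge0.
rewrite -addeA; apply: (le_trans (leeD2l _ (step hn))).
rewrite addeA.
have -> : (C * (h *+ n.+1 - h *+ n) = C * h)%R by rewrite mulrS addrK.
have -> : (1 + (C * h) ^+ 2 *+ n.+1 = 1 + (C * h) ^+ 2 *+ n + (C * h) ^+ 2)%R.
  by rewrite mulrSr addrA.
by rewrite [leRHS]EFinD; apply: leeD.
Qed.

Lemma survival_integral_le1 :
  \int[leb]_(t in `]0%R, +oo[) (beta t * decay t) <= 1.
Proof.
have mbd : measurable_fun pos (fun t => beta t * decay t) by exact: emeasurable_funM.
have upto T : (0 <= T)%R -> \int[leb]_(v in `]0%R, T]) (beta v * decay v) <= 1.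
  move=> T0; apply/lee_addgt0Pr => eps eps0.
  have [n nlt] : exists n, (((C * T) ^+ 2) / eps < n.+1%:R)%R.
    exists (Num.truncn ((C * T) ^+ 2 / eps)); exact: truncnS_gt.
  have n0 : (0 < n.+1%:R :> R)%R by rewrite ltr0n.
  have h0 : (0 <= T / n.+1%:R)%R by rewrite divr_ge0.
  have := partial n.+1 h0.
  have -> : (T / n.+1%:R *+ n.+1 = T)%R by rewrite -mulr_natr divfK ?gt_eqF.
  move=> h; apply: (@le_trans _ _ (1 + ((C * (T / n.+1%:R)) ^+ 2) *+ n.+1)%:E).
    by apply: le_trans h; rewrite leeDl.
  rewrite -EFinD lee_fin lerD2l -mulr_natr.
  have -> : ((C * (T / n.+1%:R)) ^+ 2 * n.+1%:R = (C * T) ^+ 2 / n.+1%:R)%R.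
    by field; rewrite addrC natr1 pnatr_eq0.
  by rewrite ler_pdivrMr// [leRHS]mulrC -ler_pdivrMr// ltW.
have U : \bigcup_n (`]0%R, n%:R]%classic : set R) = pos.
  apply/seteqP; split=> [t [n _]/=|t /=]; first by rewrite !in_itv/= andbT => /andP[].
  rewrite in_itv/= andbT => t0; exists (Num.truncn t).+1 => //=.
  by rewrite in_itv/= t0 ltW// truncnS_gt.
rewrite -U.
have nd : nondecreasing_seq (fun n : nat => `]0%R, n%:R]%classic : set R).
  move=> m n mn; rewrite subsetEset => t /=; rewrite !in_itv/= => /andP[-> tm].
  by rewrite (le_trans tm)// ler_nat.
have cvgI : \int[leb]_(x in `]0%R, n%:R]) (beta x * decay x) @[n --> \oo] -->
    \int[leb]_(x in \bigcup_n (`]0%R, n%:R]%classic : set R)) (beta x * decay x).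
  apply: ge0_nondecreasing_set_cvg_integral => // n.
    by apply: measurable_funS mbd => //; exact: sub_pos.
  move=> t /(sub_pos (lexx _))/=; rewrite in_itv/= andbT => t0.
  by rewrite mule_ge0// beta_ge0.
rewrite -(cvg_lim _ cvgI)//; apply: lime_le; first by apply/cvg_ex; eexists; exact: cvgI.
by apply: nearW => n; exact: upto.
Qed.

End survival_integral.

(** * Discounting *)

Section discounting.
Context (R : realType) (alpha : R).
Hypothesis alpha_gt0 : (0 < alpha)%R.
Local Notation leb := (@lebesgue_measure R).

Definition discount_rate (t : R) : \bar R := (alpha * expR (- alpha * t))%:E.

Lemma discount_rate_ge0 t : 0 <= discount_rate t.
Proof. by rewrite lee_fin mulr_ge0 ?expR_ge0// ltW. Qed.

Lemma measurable_discount_rate : measurable_fun setT discount_rate.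
Proof.
apply/measurable_EFinP; apply: measurable_funM => //.
by apply: measurableT_comp => //; exact: measurable_funM.
Qed.

(** By the fundamental theorem of calculus on a half-line, with primitive
    - exp(- alpha t). *)
Lemma integral_discount_tail (a : R) :
  \int[leb]_(t in `]a, +oo[) discount_rate t = (expR (- alpha * a))%:E.
Proof.
have cexp : continuous (fun z : R^o => expR (- alpha * z)).
  move=> z; apply: continuous_comp; last exact: continuous_expR.
  by apply: continuousM => //; apply: (@continuousN _ R^o); exact: cst_continuous.
rewrite integral_itv_obnd_cbnd; last first.
  exact: measurable_funTS measurable_discount_rate.
rewrite (@ge0_continuous_FTC2y _ (fun t => alpha * expR (- alpha * t))%R
  (fun x => - (expR (- alpha * x)))%R a 0%R)//.
- by rewrite EFinN oppeK add0e.
- by move=> x _; rewrite mulr_ge0 ?expR_ge0// ltW.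
- apply: continuous_subspaceT => x.
  apply: (@continuousM _ R^o (fun=> alpha) (fun x => expR (- alpha * x))%R).
    exact: cst_continuous.
  exact: cexp.
- rewrite -oppr0; apply: cvgN.
  rewrite (_ : (fun x => expR (- alpha * x)%R) =
               (fun z => expR (- z)%R) \o (fun z => alpha * z)%R); last first.
    by apply: eq_fun => x; rewrite mulNr.
  apply: (@cvg_comp _ _ _ _ _ _ (pinfty_nbhs R)); last exact: cvgr_expR.
  exact: gt0_cvgMry.
- by apply: cvgN; apply/cvg_at_right_filter; exact: cexp.
- move=> z _.
  rewrite derive1_comp// derive1N// derive1_id mulN1r derive1_comp// derive1E.
  have /funeqP -> := @derive_expR R.
  by rewrite derive1Ml// derive1_id mulr1 mulrN opprK mulrC.
Qed.

(** Exponential on the extended reals, so that the discount at an infinite jump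
    time is 0. *)
Definition discount (s : \bar R) : \bar R := expeR (- (alpha%:E * s)).

Lemma discount_ge0 s : 0 <= discount s. Proof. exact: expeR_ge0. Qed.

Lemma discount_fin (s : R) : discount s%:E = (expR (- alpha * s))%:E.
Proof. by rewrite /discount -EFinM -EFinN /= mulNr. Qed.

Lemma discount_y : discount +oo = 0.
Proof. by rewrite /discount gt0_muley ?lte_fin. Qed.

Lemma discount_le1 s : 0 <= s -> discount s <= 1.
Proof.
move=> s0; rewrite -(@expeR0 R) lee_expeR oppe_le0 mule_ge0//.
by rewrite lee_fin ltW.
Qed.

Lemma discountD s t : 0 <= s -> 0 <= t ->
  discount (s + t) = discount s * discount t.
Proof.
move=> s0 t0; have a0 : 0 <= alpha%:E by rewrite lee_fin ltW.
rewrite /discount -expeRD ge0_muleDr// oppeD// ge0_adde_def// inE mule_ge0//.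
Qed.

Lemma measurable_discount : measurable_fun setT discount.
Proof.
apply: (measurableT_comp (@measurable_expeR R)).
by apply: measurableT_comp => //; exact: measurable_funeM.
Qed.

Lemma nnmeasurable_discount d (T : measurableType d) (f : T -> \bar R) :
  measurable_fun setT f -> nnmeasurable (fun x => discount (f x)).
Proof.
move=> mf; split; last by move=> x; exact: discount_ge0.
exact: (measurableT_comp measurable_discount mf).
Qed.

Definition discount_between (s s' : \bar R) : \bar R :=
  \int[leb]_(t in `]0%R, +oo[) if s < t%:E <= s' then discount_rate t else 0.

(** Stated as a sum because a subtraction of extended reals would need side
    conditions in the integrated form. *)
Lemma discount_betweenE s s' : 0 <= s -> s <= s' ->
  discount_between s s' + discount s' = discount s.
Proof.
case: s => [s| |]// s0; last first.
  rewrite leye_eq => /eqP ->; rewrite discount_y adde0.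
  by rewrite /discount_between; apply: integral0_eq.
move=> ss'; rewrite /discount_between.
have mf (D : set R) : measurable_fun D discount_rate.
  by apply: measurable_funTS; exact: measurable_discount_rate.
have E (D : set R) : D `<=` `]0%R, +oo[ -> (forall t, D t <-> s%:E < t%:E <= s') ->
    \int[leb]_(t in `]0%R, +oo[) (if s%:E < t%:E <= s' then discount_rate t else 0) =
    \int[leb]_(t in D) discount_rate t.
  move=> D0 DE; rewrite -[in RHS](setIidr D0) integral_mkcondr.
  apply: eq_integral => t _; rewrite patchE; case: ifPn => [/DE/mem_set ->//|].
  by case: ifPn => // /set_mem/DE ->.
case: s' ss' E => [s'| |]// ss' E; last first.
  rewrite (E `]s, +oo[%classic).
  - by rewrite discount_y adde0 integral_discount_tail discount_fin.
  - move=> t /=; rewrite !in_itv/= !andbT; apply: le_lt_trans.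
    by rewrite -lee_fin.
  - by move=> t; rewrite /= in_itv/= lte_fin leey.
rewrite (E `]s, s']%classic); last 2 first.
- move=> t /=; rewrite !in_itv/= !andbT => /andP[+ _]; apply: le_lt_trans.
  by rewrite -lee_fin.
- by move=> t; rewrite /= in_itv/= lte_fin lee_fin.
rewrite !discount_fin -!integral_discount_tail -ge0_integral_setU//.
- by rewrite -itv_bndbnd_setU// bnd_simp.
- exact: mf.
- by move=> t _; exact: discount_rate_ge0.
- rewrite disj_set2E; apply/eqP/seteqP; split => // v /=.
  rewrite !in_itv/= andbT => -[/andP[_ vs] sv].
  by move: vs; rewrite leNgt sv.
Qed.

End discounting.

(** * Discounted drift along the jumps *)

(** With K = A - L the step says
    alpha (A (k+1) - A k) + (alpha - rho) L k + b (M (k+1) - M k) <= 0. *)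
Lemma telescoped_balance (R : realDomainType) (alpha rho b : R)
    (A L K M : nat -> R) (n : nat) : (0 <= b)%R ->
  (forall k, alpha * A k.+1 + rho * K k + b * M k.+1 <=
             alpha * K k + rho * A k + b * M k)%R ->
  (forall k, L k + K k = A k)%R -> (M 0%N <= 1)%R ->
  ((alpha - rho) * (\sum_(0 <= k < n) L k) + alpha * A n + b * M n <=
   alpha * A 0%N + b)%R.
Proof.
move=> b0 step LK M0; elim: n => [|n ih].
  by rewrite big_geq// mulr0 add0r lerD2l ler_piMr.
rewrite big_nat_recr//=; apply: le_trans ih.
by move: (step n); rewrite -!LK; nra.
Qed.

(** Elimination of L: alpha times the second hypothesis, in which alpha L is
    bounded by 1 - U through the first. *)
Lemma drift_balance (R : realDomainType) (alpha rho b w : R) (U V L : \bar R) :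
  (0 < alpha)%R -> (0 <= rho)%R -> (0 <= b)%R -> (0 <= w)%R ->
  0 <= U -> 0 <= V -> 0 <= L -> U + alpha%:E * L <= 1 ->
  V <= U * w%:E + (rho * w + b)%:E * L ->
  alpha%:E * V + rho%:E * (w%:E * U) + b%:E * U <=
  alpha%:E * (w%:E * U) + rho%:E * w%:E + b%:E.
Proof.
move=> a0 r0 b0 w0 U0 V0 L0 h1 h2.
have aL0 : 0 <= alpha%:E * L by rewrite mule_ge0// lee_fin ltW.
have Ufin : U \is a fin_num.
  rewrite ge0_fin_numE//; apply: le_lt_trans (ltry 1%R).
  by apply: le_trans h1; rewrite leeDl.
have Lfin : L \is a fin_num.
  rewrite ge0_fin_numE// ltNge leye_eq; apply/eqP => Loo.
  by move: h1; rewrite Loo gt0_muley ?lte_fin// addey ?gt_eqF// (lt_le_trans _ U0).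
move: Ufin Lfin U0 V0 L0 h1 h2 {aL0}; case: U => [U| |]// _; case: L => [L| |]// _.
case: V => [V| |]// U0 V0 L0; rewrite -!EFinM -!EFinD !lee_fin// => h1 h2.
rewrite lee_fin in U0; rewrite lee_fin in L0.
have h3 := ler_wpM2l (ltW a0) h2.
have c0 : (0 <= rho * w + b)%R by rewrite addr_ge0// mulr_ge0.
have h4 := ler_wpM2l c0 h1.
by move: h3 h4; nra.
Qed.

Section drift_estimate.
Context dS (S : measurableType dS) dA (A : measurableType dA) (R : realType).
Variables (adm : S -> set A) (q : S -> A -> {charge set S -> \bar R}).
Hypothesis madm : forall x, measurable (adm x).
Hypothesis mK : measurable (adm_graph adm).
Hypothesis rates : transition_rates adm q.
Hypothesis mdiag : measurable [set z : S * S | z.1 = z.2].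
Variable pi : R.-pker (predictable S R) ~> (option A).
Hypothesis pi_policy : policy adm pi.
Local Notation Om := (Omega S R).
Variable gamma : {measure set S -> \bar R}.
Variable P : probability Om R.
Hypothesis Plaw : strategic_measure q pi gamma P.

Variables (alpha rho b : R) (w : S -> R).
Hypothesis alpha_gt0 : (0 < alpha)%R.
Hypothesis rho_ge0 : (0 <= rho)%R.
Hypothesis b_ge0 : (0 <= b)%R.
Hypothesis mw : measurable_fun setT w.
Hypothesis w_ge0 : forall x, (0 <= w x)%R.
Hypothesis w_drift : forall x a, adm x a ->
  charge_integral (q x a) (fun y => (w y)%:E) <= (rho * w x + b)%:E.

Local Notation leb := (@lebesgue_measure R).
Local Notation haz := (hazard adm q pi).
Local Notation surv := (survival adm q pi).
Local Notation wE := (fun y => (w y)%:E).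
Local Notation W k := (fun e : Om => at_state (path_state e k) wE).
Local Notation disc k := (fun e : Om => discount alpha (jump_time e k)).

Lemma nnmeasurable_weight : nnmeasurable wE.
Proof. by split=> [|x]; [exact/measurable_EFinP|rewrite lee_fin]. Qed.

Let nn_haz k u : nnmeasurable u -> nnmeasurable (haz k u).
Proof. exact: nnmeasurable_hazard. Qed.

Let nn_surv k : nnmeasurable (surv k).
Proof. exact: nnmeasurable_survival. Qed.

Let mal k : measurable (alive k : set Om). Proof. exact: measurable_alive. Qed.

Lemma nnmeasurable_disc k : nnmeasurable (disc k).
Proof. by apply: nnmeasurable_discount; exact: measurable_jump_time. Qed.

Lemma nnmeasurable_W k : nnmeasurable (W k).
Proof.
split; first exact: (measurable_at_path_state k nnmeasurable_weight).
by move=> e; apply: at_state_ge0 => y; rewrite lee_fin.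
Qed.

Lemma disc_dead k (e : Om) : path_state e k = None ->
  discount alpha (jump_time e k) = 0.
Proof.
move=> ek; have -> : jump_time e k = +oo; last exact: discount_y.
apply/eqP; rewrite eq_le leey leNgt /=; apply/negP => /jump_time_finP.
by rewrite ek.
Qed.

Let nn_discount_time :
  nnmeasurable (fun z : Om * R => discount alpha z.2%:E).
Proof. by apply: nnmeasurable_discount; exact/measurable_EFinP. Qed.

Let kernel_arg k u := fun z : Om * R =>
  discount alpha z.2%:E * (haz k u z * surv k z).

Let nn_kernel_arg k u : nnmeasurable u -> nnmeasurable (kernel_arg k u).
Proof.
move=> mu; apply: nnmeasurableM; first exact: nn_discount_time.
by apply: nnmeasurableM; [exact: nn_haz|exact: nn_surv].
Qed.

(** The conditional expectation, given the history up to the [k]-th jump, of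
    exp(- alpha theta) u(y) for the next sojourn time theta and state y. *)
Definition next_jump k u (e : Om) : \bar R :=
  \int[leb]_(t in `]0%R, +oo[)
    (discount alpha t%:E * (haz k u (e, t) * surv k (e, t))).

Lemma nnmeasurable_next_jump k u : nnmeasurable u -> nnmeasurable (next_jump k u).
Proof. by move=> mu; exact: (nnmeasurable_integral_pos (nn_kernel_arg k mu)). Qed.

(** The discount at the next jump factors into the discount at the present
    jump, a function of the history, and the discount of the sojourn time. *)
Lemma law_discount k (g : option S -> \bar R) (u : S -> \bar R) :
  nnmeasurable g -> nnmeasurable u ->
  \int[P]_e (discount alpha (jump_time e k.+1) *
    (g (path_state e k) * at_state (path_state e k.+1) u)) =
  \int[P]_(e in alive k) (discount alpha (jump_time e k) * g (path_state e k) *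
    next_jump k u e).
Proof.
move=> mg mu.
pose f (z : history S R k * R) : \bar R :=
  discount alpha (\sum_(i < k) tnth z.1.2 i) * g (tnth z.1.1 ord_max) *
  discount alpha z.2%:E.
have fE e t : f (hist k e, t) =
    discount alpha (jump_time e k) * g (path_state e k) * discount alpha t%:E.
  rewrite /f /= tnth_mktuple; congr (discount _ _ * _ * _).
  by apply: eq_bigr => i _; rewrite tnth_mktuple.
have mf : nnmeasurable f.
  apply: nnmeasurableM; first apply: nnmeasurableM.
  - apply: nnmeasurable_discount; apply: emeasurable_sum => i.
    apply: (measurableT_comp (measurable_tnth i)).
    exact: measurableT_comp.
  - split; last by move=> z; exact: mg.2.
    apply: (measurableT_comp mg.1).
    apply: (measurableT_comp (measurable_tnth ord_max)).
    exact: measurableT_comp.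
  - by apply: nnmeasurable_discount; exact/measurable_EFinP.
have := next_jump_law madm mK rates mdiag pi_policy Plaw mf mu.
rewrite (_ : \int[P]_(e in alive k) (f _ * _) = \int[P]_e
    (discount alpha (jump_time e k.+1) *
    (g (path_state e k) * at_state (path_state e k.+1) u))); last first.
  rewrite integral_mkcond; apply: eq_integral => e _; rewrite patchE.
  case ex : (path_state e k.+1) => [y|]; last first.
    by rewrite disc_dead// mul0e /at_state/= mule0; case: ifP.
  have ek : path_state e k <> None by apply: path_stateS; rewrite ex.
  rewrite mem_set// fE fineK; last first.
    rewrite ge0_fin_numE; last exact/ltW/path_sojourn_gt0.
    by apply/path_sojourn_finP; rewrite ex.
  rewrite jump_timeS (discountD alpha_gt0) ?jump_time_ge0//; last first.
    exact/ltW/path_sojourn_gt0.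
  by rewrite -!muleA; congr (_ * _); rewrite muleCA.
move=> ->; apply: eq_integral => e _.
under eq_integral do rewrite fE -muleA.
rewrite ge0_integralZl//.
- apply: measurable_funTS.
  exact: (measurable_fun_pair2 (e : Om) (nn_kernel_arg k mu).1).
- by move=> t _; exact: (nn_kernel_arg k mu).2 (e, t).
- by rewrite mule_ge0 ?discount_ge0//; exact: mg.2.
Qed.

Section one_path.
Variables (k : nat) (e : Om) (x : S).
Hypothesis ex : path_state e k = Some x.

Let L := \int[leb]_(t in `]0%R, +oo[) (discount alpha t%:E * surv k (e, t)).

Let m1 : nnmeasurable (cst 1 : S -> \bar R). Proof. exact: nnmeasurable1. Qed.

Let mslice (g : Om * R -> \bar R) (D : set R) : nnmeasurable g ->
  measurable_fun D (fun t => g (e, t)).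
Proof.
by move=> mg; apply: measurable_funTS; exact: (measurable_fun_pair2 (e : Om) mg.1).
Qed.

Let nn_ds : nnmeasurable (fun z : Om * R => discount alpha z.2%:E * surv k z).
Proof. by apply: nnmeasurableM; [exact: nn_discount_time|exact: nn_surv]. Qed.

(** Discounting is killing at rate alpha: adding alpha to the hazard rate
    multiplies the survival function by the discount. *)
Lemma discounted_survival_le1 : next_jump k (cst 1) e + alpha%:E * L <= 1.
Proof.
have [C C0 ub] := jump_rate_bound rates mdiag x.
pose beta t := alpha%:E + haz k (cst 1) (e, t).
have haz0 t : 0 <= haz k (cst 1) (e, t) by exact: (nn_haz k m1).2.
have a0 : 0 <= alpha%:E by rewrite lee_fin ltW.
have mhaz (D : set R) : measurable_fun D (fun t => haz k (cst 1) (e, t)).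
  exact: (@mslice _ _ (nn_haz k m1)).
have mbeta (D : set R) : measurable_fun D beta by exact: emeasurable_funD.
have decayE t : (0 < t)%R ->
    expeR (- \int[leb]_(v in `]0%R, t]) beta v) =
    discount alpha t%:E * surv k (e, t).
  move=> t0.
  have -> : \int[leb]_(v in `]0%R, t]) beta v =
      alpha%:E * t%:E + \int[leb]_(v in `]0%R, t]) haz k (cst 1) (e, v).
    rewrite /beta ge0_integralD//; last exact: mhaz.
    congr (_ + _).
    by rewrite integral_cst//= lebesgue_measure_itv/= lte_fin t0 EFinN oppe0 adde0.
  rewrite addeC fin_num_oppeD; last by rewrite -EFinM.
  by rewrite expeRD muleC.
have := @survival_integral_le1 R beta (alpha + C) (mbeta _).
have -> : \int[leb]_(t in `]0%R, +oo[) (beta t *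
    expeR (- \int[leb]_(v in `]0%R, t]) beta v)) =
    next_jump k (cst 1) e + alpha%:E * L.
  rewrite /next_jump /L -ge0_integralZl//; last 2 first.
  - exact: (@mslice _ _ nn_ds).
  - by move=> t _; exact: (nn_ds.2 (e, t)).
  rewrite -ge0_integralD//; last 4 first.
  - by move=> t _; exact: ((nn_kernel_arg k m1).2 (e, t)).
  - exact: (@mslice _ _ (nn_kernel_arg k m1)).
  - by move=> t _; rewrite mule_ge0//; exact: (nn_ds.2 (e, t)).
  - by apply: emeasurable_funM => //; exact: (@mslice _ _ nn_ds).
  apply: eq_integral => t; rewrite mem_setE in_itv/= andbT => t0.
  rewrite decayE// /beta ge0_muleDl// addeC; congr (_ + _).
  by rewrite muleCA.
apply.
- by rewrite addr_ge0// ltW.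
- by move=> t _; rewrite adde_ge0.
- move=> t t0; rewrite EFinD leeD2l//.
  exact: (hazard_le_cst madm mK rates mdiag pi_policy ex t0 C0 ub).
- apply: (eq_measurable_fun (fun t => discount alpha t%:E * surv k (e, t))).
    by move=> t /[!inE]/=; rewrite in_itv/= andbT => /decayE ->.
  exact: (@mslice _ _ nn_ds).
Qed.

(** The drift condition, averaged over the policy and integrated against the
    discounted survival function. *)
Lemma next_jump_drift : next_jump k wE e <=
  next_jump k (cst 1) e * (w x)%:E + (rho * w x + b)%:E * L.
Proof.
have mwt := nnmeasurable_weight.
have wx0 : 0 <= (w x)%:E by rewrite lee_fin.
have c0 : (0 <= rho * w x + b)%R by rewrite addr_ge0// mulr_ge0.
have c0' : 0 <= (rho * w x + b)%:E by rewrite lee_fin.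
rewrite /next_jump /L -ge0_integralZr//; last 2 first.
- exact: (@mslice _ _ (nn_kernel_arg k m1)).
- by move=> t _; exact: ((nn_kernel_arg k m1).2 (e, t)).
rewrite -ge0_integralZl//; last 2 first.
- exact: (@mslice _ _ nn_ds).
- by move=> t _; exact: (nn_ds.2 (e, t)).
have i1 t : 0 <= discount alpha t%:E * (haz k (cst 1) (e, t) * surv k (e, t)) * (w x)%:E.
  by rewrite mule_ge0//; exact: ((nn_kernel_arg k m1).2 (e, t)).
have i2 t : 0 <= (rho * w x + b)%:E * (discount alpha t%:E * surv k (e, t)).
  by rewrite mule_ge0//; exact: (nn_ds.2 (e, t)).
have mi1 : measurable_fun (`]0%R, +oo[%classic : set R) (fun t =>
    discount alpha t%:E * (haz k (cst 1) (e, t) * surv k (e, t)) * (w x)%:E).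
  by apply: emeasurable_funM => //; exact: (@mslice _ _ (nn_kernel_arg k m1)).
have mi2 : measurable_fun (`]0%R, +oo[%classic : set R) (fun t =>
    (rho * w x + b)%:E * (discount alpha t%:E * surv k (e, t))).
  by apply: emeasurable_funM => //; exact: (@mslice _ _ nn_ds).
rewrite -ge0_integralD//; apply: ge0_le_integral => //.
- by move=> t _; exact: ((nn_kernel_arg k mwt).2 (e, t)).
- exact: (@mslice _ _ (nn_kernel_arg k mwt)).
- exact: emeasurable_funD.
move=> t /=; rewrite in_itv/= andbT => t0.
have s0 := (nn_surv k).2 (e, t).
have d0 : 0 <= discount alpha t%:E by exact: discount_ge0.
have h0 : 0 <= haz k (cst 1) (e, t) by exact: (nn_haz k m1).2.
have H : haz k wE (e, t) <=
    (rho * w x + b)%:E + haz k (cst 1) (e, t) * (w x)%:E.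
  apply: (hazard_le madm mK rates mdiag pi_policy ex t0 mwt c0 (w_ge0 x)) => a xa.
  apply: (jump_rate_drift rates mdiag xa mwt) => //; first exact: ltry.
  exact: w_drift.
rewrite -muleA [X in _ + X]muleCA -ge0_muleDr; last 2 first.
- by rewrite !mule_ge0.
- by rewrite mule_ge0.
apply: lee_wpmul2l => //.
rewrite muleAC -ge0_muleDl ?mule_ge0//.
by apply: lee_wpmul2r => //; rewrite addeC.
Qed.

Lemma one_path_inequality :
  alpha%:E * next_jump k wE e + rho%:E * ((w x)%:E * next_jump k (cst 1) e) +
    b%:E * next_jump k (cst 1) e <=
  alpha%:E * ((w x)%:E * next_jump k (cst 1) e) + rho%:E * (w x)%:E + b%:E.
Proof.
apply: (@drift_balance _ _ _ _ _ _ _ L) => //.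
- exact: (nnmeasurable_next_jump k m1).2.
- exact: (nnmeasurable_next_jump k nnmeasurable_weight).2.
- by apply: integral_ge0 => t _; exact: (nn_ds.2 (e, t)).
- exact: discounted_survival_le1.
- exact: next_jump_drift.
Qed.

End one_path.

Let nnW := nnmeasurable_weight.
Let nn1 : nnmeasurable (cst 1 : S -> \bar R) := @nnmeasurable1 _ S R.
Let nnWk k : nnmeasurable (W k) := nnmeasurable_W k.
Let nnd k : nnmeasurable (disc k) := nnmeasurable_disc k.
Let nnj k u (mu : nnmeasurable u) := nnmeasurable_next_jump k mu.

Lemma integral_alive k (g : Om -> \bar R) :
  \int[P]_(e in alive k) (discount alpha (jump_time e k) * g e) =
  \int[P]_e (discount alpha (jump_time e k) * g e).
Proof.
rewrite integral_mkcond; apply: eq_integral => e _; rewrite patchE.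
case: ifPn => //; rewrite notin_setE /alive/= => /contrapT ek.
by rewrite disc_dead// mul0e.
Qed.

(** These are a_k, u_k and n_k: [weight_at] is the expected discounted weight
    at the [k]-th jump, [weight_kept] is what remains of it when the same state
    is discounted up to the next jump, and [mass_at] is the expected discount
    at the [k]-th jump. *)
Definition weight_at k := \int[P]_e (discount alpha (jump_time e k) * W k e).

Definition weight_kept k := \int[P]_e (discount alpha (jump_time e k.+1) * W k e).

Definition mass_at k := \int[P]_e discount alpha (jump_time e k).

Lemma weight_at_ge0 k : 0 <= weight_at k.
Proof.
by apply: integral_ge0 => e _; apply: mule_ge0; [exact: discount_ge0|exact: (nnWk k).2].
Qed.

Lemma weight_kept_ge0 k : 0 <= weight_kept k.
Proof.
by apply: integral_ge0 => e _; apply: mule_ge0; [exact: discount_ge0|exact: (nnWk k).2].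
Qed.

Lemma mass_at_ge0 k : 0 <= mass_at k.
Proof. by apply: integral_ge0 => e _; exact: discount_ge0. Qed.

Lemma mass_at_le1 k : mass_at k <= 1.
Proof.
apply: (@le_trans _ _ (\int[P]_e cst 1 e)).
  apply: ge0_le_integral => //.
  - by move=> e _; exact: discount_ge0.
  - exact: (nnd k).1.
  - by move=> e _; apply: discount_le1 => //; exact: jump_time_ge0.
by rewrite integral_cst// mul1e probability_le1.
Qed.

Lemma weight_at_next k : weight_at k.+1 =
  \int[P]_(e in alive k) (discount alpha (jump_time e k) * next_jump k wE e).
Proof.
have := law_discount k
  (@nnmeasurable1 _ (option S) R) nnW.
under [in RHS]eq_integral do rewrite mule1.
by move=> <-; apply: eq_integral => e _; rewrite mul1e.
Qed.

Lemma mass_at_next k : mass_at k.+1 =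
  \int[P]_(e in alive k) (discount alpha (jump_time e k) * next_jump k (cst 1) e).
Proof.
have := law_discount k
  (@nnmeasurable1 _ (option S) R) nn1.
under [in RHS]eq_integral do rewrite mule1.
move=> <-; apply: eq_integral => e _; rewrite mul1e.
case ex : (path_state e k.+1) => [y|]; first by rewrite /at_state/= mule1.
by rewrite disc_dead// mul0e.
Qed.

Lemma weight_kept_next k : weight_kept k =
  \int[P]_(e in alive k) (discount alpha (jump_time e k) *
    (W k e * next_jump k (cst 1) e)).
Proof.
have mWo : nnmeasurable (fun x : option S => at_state x wE).
  split; first exact: (measurable_at_state nnW.1).
  by move=> x; exact: at_state_ge0 nnW.2.
have := law_discount k mWo nn1.
under [in RHS]eq_integral do rewrite -muleA.
move=> <-; apply: eq_integral => e _.
case ex : (path_state e k.+1) => [y|]; first by rewrite {2}/at_state/= mule1.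
by rewrite disc_dead// !mul0e.
Qed.

(** [one_path_inequality] multiplied by the discount at the [k]-th jump and
    integrated. *)
Lemma drift_step k :
  alpha%:E * weight_at k.+1 + rho%:E * weight_kept k + b%:E * mass_at k.+1 <=
  alpha%:E * weight_kept k + rho%:E * weight_at k + b%:E * mass_at k.
Proof.
rewrite weight_at_next weight_kept_next mass_at_next.
rewrite /weight_at /mass_at -(integral_alive k (W k)).
have -> : \int[P]_e discount alpha (jump_time e k) =
    \int[P]_(e in alive k) (discount alpha (jump_time e k) * cst 1 e).
  by rewrite integral_alive; apply: eq_integral => e _; rewrite mule1.
have nnD (g : Om -> \bar R) : nnmeasurable g ->
    nnmeasurable (fun e : Om => discount alpha (jump_time e k) * g e).
  by move=> mg; apply: nnmeasurableM.
have lin (c : R) (g : Om -> \bar R) : (0 <= c)%R -> nnmeasurable g ->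
    c%:E * \int[P]_(e in alive k) (discount alpha (jump_time e k) * g e) =
    \int[P]_(e in alive k) (discount alpha (jump_time e k) * (c%:E * g e)).
  move=> c0 mg; rewrite -ge0_integralZl//.
  - by apply: eq_integral => e _; rewrite muleCA.
  - by apply: measurable_funTS; exact: (nnD _ mg).1.
  - by move=> e _; exact: (nnD _ mg).2.
have add (g h : Om -> \bar R) : nnmeasurable g -> nnmeasurable h ->
    \int[P]_(e in alive k) (discount alpha (jump_time e k) * g e) +
    \int[P]_(e in alive k) (discount alpha (jump_time e k) * h e) =
    \int[P]_(e in alive k) (discount alpha (jump_time e k) * (g e + h e)).
  move=> mg mh; rewrite -ge0_integralD//.
  - by apply: eq_integral => e _; rewrite ge0_muleDr//; [exact: mg.2|exact: mh.2].
  - by move=> e _; exact: (nnD _ mg).2.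
  - by apply: measurable_funTS; exact: (nnD _ mg).1.
  - by move=> e _; exact: (nnD _ mh).2.
  - by apply: measurable_funTS; exact: (nnD _ mh).1.
have nnZ (c : R) (g : Om -> \bar R) : (0 <= c)%R -> nnmeasurable g ->
    nnmeasurable (fun e => c%:E * g e).
  move=> c0 mg; apply: nnmeasurableM => //; exact: nnmeasurable_cst.
have nnV := nnj k nnW; have nnU := nnj k nn1.
have nnWU := nnmeasurableM (nnWk k) nnU.
have a0 := ltW alpha_gt0.
have nn1O := @nnmeasurable1 _ Om R.
have A1 := nnZ _ _ a0 nnV; have A2 := nnZ _ _ rho_ge0 nnWU.
have A3 := nnZ _ _ b_ge0 nnU; have B1 := nnZ _ _ a0 nnWU.
have B2 := nnZ _ _ rho_ge0 (nnWk k); have B3 := nnZ _ _ b_ge0 nn1O.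
have A12 := nnmeasurableD A1 A2; have B12 := nnmeasurableD B1 B2.
rewrite (lin _ _ a0 nnV) (lin _ _ rho_ge0 nnWU) (lin _ _ b_ge0 nnU).
rewrite (lin _ _ a0 nnWU) (lin _ _ rho_ge0 (nnWk k)) (lin _ _ b_ge0 nn1O).
rewrite (add _ _ A1 A2) (add _ _ A12 A3) (add _ _ B1 B2) (add _ _ B12 B3).
have A123 := nnD _ (nnmeasurableD A12 A3); have B123 := nnD _ (nnmeasurableD B12 B3).
apply: ge0_le_integral; first exact: mal.
- by move=> e _; exact: A123.2.
- exact: measurable_funTS A123.1.
- exact: measurable_funTS B123.1.
move=> e ek; apply: lee_wpmul2l; first exact: discount_ge0.
case ex : (path_state e k) => [x|]; last by case: ek.
rewrite mule1 /at_state/=.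
exact: (one_path_inequality ex).
Qed.

(** The difference of [weight_at] and [weight_kept], in the form of an integral
    over the [k]-th sojourn interval. *)
Definition weight_lost k :=
  \int[P]_e (discount_between alpha (jump_time e k) (jump_time e k.+1) * W k e).

Lemma nnmeasurable_between k : nnmeasurable (fun z : Om * R =>
  if jump_time z.1 k < z.2%:E <= jump_time z.1 k.+1 then discount_rate alpha z.2 else 0).
Proof.
split; last by move=> z; case: ifP => // _; exact: discount_rate_ge0.
have mT n : measurable_fun setT (fun z : Om * R => jump_time z.1 n).
  exact: (measurableT_comp (@measurable_jump_time _ S R n) measurable_fst).
have m2 : measurable_fun setT (fun z : Om * R => z.2%:E) by exact/measurable_EFinP.
apply: measurable_fun_ifT => //.
  by apply: measurable_and; [exact: measurable_fun_lte|exact: measurable_fun_lee].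
exact: (measurableT_comp (measurable_discount_rate alpha) measurable_snd).
Qed.

Lemma nnmeasurable_discount_between k : nnmeasurable (fun e : Om =>
  discount_between alpha (jump_time e k) (jump_time e k.+1)).
Proof. exact: (nnmeasurable_integral_pos (nnmeasurable_between k)). Qed.

Lemma weight_lost_ge0 k : 0 <= weight_lost k.
Proof.
apply: integral_ge0 => e _; apply: mule_ge0; last exact: (nnWk k).2.
exact: (nnmeasurable_discount_between k).2.
Qed.

Lemma weight_lostD k : weight_lost k + weight_kept k = weight_at k.
Proof.
have nnl := nnmeasurableM (nnmeasurable_discount_between k) (nnWk k).
have nnk := nnmeasurableM (nnd k.+1) (nnWk k).
rewrite /weight_lost /weight_kept -ge0_integralD//; last 4 first.
- by move=> e _; exact: nnl.2.
- exact: nnl.1.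
- by move=> e _; exact: nnk.2.
- exact: nnk.1.
apply: eq_integral => e _; rewrite -ge0_muleDl.
- rewrite discount_betweenE//; first exact: jump_time_ge0.
  exact: le_jump_time.
- exact: (nnmeasurable_discount_between k).2.
- exact: discount_ge0.
Qed.

Lemma weight_at_initial : weight_at 0 = \int[gamma]_x wE x.
Proof.
rewrite -(initial_law Plaw nnW); apply: eq_integral => e _.
by rewrite jump_time0 discount_fin mulr0 expR0 mul1e.
Qed.

Section finite_initial_weight.
Hypothesis weight_at0 : weight_at 0 < +oo.

(** Finiteness propagates along the jumps through [drift_step], whose right side
    involves the [k]-th jump only; it turns the telescoping into one of real
    numbers. *)
Lemma weight_at_fin k : weight_at k < +oo.
Proof.
elim: k => [//|k ih].
have kept : weight_kept k < +oo.
  by apply: le_lt_trans ih; rewrite -weight_lostD leeDr// weight_lost_ge0.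
have mass : mass_at k < +oo by apply: le_lt_trans (mass_at_le1 k) (ltry _).
have [//|] := ltP (weight_at k.+1) +oo; rewrite leye_eq => /eqP woo.
have := drift_step k; rewrite woo gt0_muley ?lte_fin//.
rewrite addye ?gt_eqF//; last first.
  by rewrite (@lt_le_trans _ _ 0)// mule_ge0 ?lee_fin// weight_kept_ge0.
rewrite addye ?gt_eqF//; last first.
  by rewrite (@lt_le_trans _ _ 0)// mule_ge0 ?lee_fin// mass_at_ge0.
have fin (u : \bar R) : 0 <= u -> u < +oo -> u \is a fin_num.
  by move=> u0 uoo; rewrite ge0_fin_numE.
rewrite -(fineK (fin _ (weight_kept_ge0 k) kept)) -(fineK (fin _ (weight_at_ge0 k) ih)).
by rewrite -(fineK (fin _ (mass_at_ge0 k) mass)).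
Qed.

Lemma telescoped_drift n :
  (alpha - rho)%:E * (\sum_(0 <= k < n) weight_lost k) + alpha%:E * weight_at n +
    b%:E * mass_at n <= alpha%:E * weight_at 0 + b%:E.
Proof.
have fin (u : \bar R) : 0 <= u -> u < +oo -> u \is a fin_num.
  by move=> u0 uoo; rewrite ge0_fin_numE.
have Afin k : weight_at k \is a fin_num.
  by apply: fin; [exact: weight_at_ge0|exact: weight_at_fin].
have Lfin k : weight_lost k \is a fin_num.
  apply: fin; first exact: weight_lost_ge0.
  apply: le_lt_trans (weight_at_fin k).
  by rewrite -weight_lostD leeDl// weight_kept_ge0.
have Kfin k : weight_kept k \is a fin_num.
  apply: fin; first exact: weight_kept_ge0.
  apply: le_lt_trans (weight_at_fin k).
  by rewrite -weight_lostD leeDr// weight_lost_ge0.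
have Mfin k : mass_at k \is a fin_num.
  apply: fin; first exact: mass_at_ge0.
  exact: le_lt_trans (mass_at_le1 k) (ltry _).
rewrite (eq_bigr (fun k => (fine (weight_lost k))%:E)) => [|k _]; last by rewrite fineK.
rewrite sumEFin -(fineK (Afin n)) -(fineK (Afin 0%N)) -(fineK (Mfin n)).
rewrite -!EFinM -!EFinD lee_fin.
apply: (@telescoped_balance _ _ _ _ (fun k => fine (weight_at k)) _
  (fun k => fine (weight_kept k)) (fun k => fine (mass_at k))) => //.
- move=> k; rewrite -lee_fin !EFinD !EFinM !fineK//.
  exact: drift_step.
- by move=> k; apply: EFin_inj; rewrite EFinD !fineK// weight_lostD.
- by rewrite -lee_fin fineK// mass_at_le1.
Qed.

Lemma weight_lost_series : (rho < alpha)%R ->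
  (alpha - rho)%:E * (\sum_(k <oo) weight_lost k) <= alpha%:E * weight_at 0 + b%:E.
Proof.
move=> ra; rewrite -nneseriesZl; last by move=> k _; exact: weight_lost_ge0.
apply: lime_le.
  apply: is_cvg_nneseries => k _ _.
  by rewrite mule_ge0 ?weight_lost_ge0// lee_fin subr_ge0 ltW.
apply: nearW => n; rewrite -ge0_sume_distrr; last by move=> k _; exact: weight_lost_ge0.
apply: le_trans (telescoped_drift n); rewrite -addeA leeDl//.
apply: adde_ge0; apply: mule_ge0.
- by rewrite lee_fin ltW.
- exact: weight_at_ge0.
- by rewrite lee_fin.
- exact: mass_at_ge0.
Qed.

End finite_initial_weight.

(** By Tonelli, the discounted weight carried by the process is collected
    sojourn interval by sojourn interval. *)
Lemma occupation_series :
  \int[leb]_(t in `]0%R, +oo[) (discount_rate alpha t *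
    \int[P]_e at_state (xi_left e t) wE) = \sum_(k <oo) weight_lost k.
Proof.
pose g (z : Om * R) : \bar R := discount_rate alpha z.2 *
  (if (0 < z.2)%R then at_state (xi_left z.1 z.2) wE else 0).
have g0 z : 0 <= g z.
  apply: mule_ge0; first exact: discount_rate_ge0.
  by case: ifP => // _; apply: at_state_ge0 => y; rewrite lee_fin.
have mg : measurable_fun setT g.
  apply: emeasurable_funM; last exact: measurable_at_xi_left nnW.
  exact: (measurableT_comp (measurable_discount_rate alpha) measurable_snd).
have mxi t : (0 < t)%R ->
    measurable_fun setT (fun e : Om => at_state (xi_left e t) wE).
  move=> t0; have := measurable_at_xi_left nnW.
  move/(measurable_fun_pair1 t); apply: eq_measurable_fun => e _ /=.
  by rewrite t0.
transitivity (\int[leb]_t \int[P]_e g (e, t)).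
  rewrite integral_mkcond; apply: eq_integral => t _.
  rewrite patchE mem_setE in_itv/= andbT /g /=; case: ifPn => t0; last first.
    by rewrite integral0_eq// => e _; rewrite mule0.
  rewrite ge0_integralZl//; first exact: mxi.
  by move=> e _; apply: at_state_ge0 => y; rewrite lee_fin.
  exact: discount_rate_ge0.
rewrite -(@fubini_tonelli _ _ _ _ _ P leb g)//.
transitivity (\int[P]_e \sum_(k <oo)
    (discount_between alpha (jump_time e k) (jump_time e k.+1) * W k e)); last first.
  rewrite integral_nneseries// => k.
    exact: (nnmeasurableM (nnmeasurable_discount_between k) (nnWk k)).1.
  by move=> e _; exact: (nnmeasurableM (nnmeasurable_discount_between k) (nnWk k)).2.
apply: eq_integral => e _.
transitivity (\int[leb]_(t in `]0%R, +oo[) \sum_(k <oo)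
    ((if jump_time e k < t%:E <= jump_time e k.+1
      then discount_rate alpha t else 0) * W k e)).
  rewrite [RHS]integral_mkcond; apply: eq_integral => t _.
  rewrite patchE mem_setE in_itv/= andbT /g /=; case: ifPn => t0; last by rewrite mule0.
  rewrite at_xi_left_series//.
  have rt0 : 0 <= discount_rate alpha t by exact: discount_rate_ge0.
  have f0 k : 0 <= if jump_time e k < t%:E <= jump_time e k.+1 then W k e else 0.
    by case: ifP => // _; exact: (nnWk k).2.
  rewrite -(nneseriesZl_ge0 rt0 f0).
  by apply: eq_eseriesr => k _; case: ifPn; rewrite ?mule0 ?mul0e.
rewrite integral_nneseries//; last 2 first.
- move=> k; apply: measurable_funTS; apply: emeasurable_funM => //.
  exact: (measurable_fun_pair2 (e : Om) (nnmeasurable_between k).1).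
- move=> k t _; apply: mule_ge0; last exact: (nnWk k).2.
  exact: ((nnmeasurable_between k).2 (e, t)).
apply: eq_eseriesr => k _; rewrite ge0_integralZr//.
- apply: measurable_funTS.
  exact: (measurable_fun_pair2 (e : Om) (nnmeasurable_between k).1).
- by move=> t _; exact: ((nnmeasurable_between k).2 (e, t)).
- exact: (nnWk k).2.
Qed.

(** When the initial weight is infinite the right side is infinite. *)
Lemma discounted_occupation : (rho < alpha)%R ->
  (alpha - rho)%:E * \int[leb]_(t in `]0%R, +oo[) (discount_rate alpha t *
    \int[P]_e at_state (xi_left e t) wE) <=
  alpha%:E * \int[gamma]_x wE x + b%:E.
Proof.
move=> ra; rewrite occupation_series -weight_at_initial.
have [w0oo|] := ltP (weight_at 0) +oo; first exact: weight_lost_series.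
by rewrite leye_eq => /eqP ->; rewrite gt0_muley ?lte_fin// addye// leey.
Qed.

End drift_estimate.

(** * Bounds for expected and discounted costs *)

Section estimates.
Context dS (S : measurableType dS) dA (A : measurableType dA) (R : realType).
Variables (adm : S -> set A) (q : S -> A -> {charge set S -> \bar R}).
Hypothesis madm : forall x, measurable (adm x).
Hypothesis mK : measurable (adm_graph adm).
Hypothesis rates : transition_rates adm q.
Hypothesis mdiag : measurable [set z : S * S | z.1 = z.2].
Variable pi : R.-pker (predictable S R) ~> (option A).
Hypothesis pi_policy : policy adm pi.
Local Notation Om := (Omega S R).
Local Notation leb := (@lebesgue_measure R).

Lemma abse_action_integral_le (e : Om) (t : R) (y : S) (v : A -> \bar R) (c : R) :
  (0 <= t)%R -> xi_left e t = Some y -> (0 <= c)%R ->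
  (forall a, adm y a -> `|v a| <= c%:E) ->
  `|action_integral (pi (e, to_time t)) v| <= c%:E.
Proof.
move=> t0 ey c0 vc.
have mN : measurable (Some @` adm y) by exact: measurable_image_Some.
have [pN N0] := policy_conull madm pi_policy t0 ey.
apply: le_trans (abse_integral_le_ae mN N0 (g := cst c%:E) _ _ _) _ => //.
- by move=> _ _ [a ya <-]; exact: vc.
- by rewrite integral_cst// pN mule1.
Qed.

Section law_estimates.
Variable gamma : {measure set S -> \bar R}.
Variable P : probability Om R.
Hypothesis Plaw : strategic_measure q pi gamma P.

(** Given the history, the [k]-th jump is followed by the next one at time [t]
    exactly only if the sojourn time takes one given value, a null event since
    its law has a density. *)
Lemma jump_time_no_atom k (t : R) :
  P [set e : Om | jump_time e k.+1 = t%:E] = 0.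
Proof.
set N := [set e : Om | _].
have mN : measurable N by exact: measurable_jump_at.
pose f (z : history S R k * R) : \bar R :=
  if \sum_(i < k) tnth z.1.2 i + z.2%:E == t%:E then 1 else 0.
have mf : nnmeasurable f.
  split; last by move=> z; rewrite /f; case: ifP.
  apply: measurable_fun_ifT => //; apply: measurable_fun_eqe => //.
  apply: emeasurable_funD; last exact/measurable_EFinP.
  apply: emeasurable_sum => i.
  apply: (measurableT_comp (measurable_tnth i)).
  exact: measurableT_comp.
have fE (e : Om) s : f (hist k e, s) = if jump_time e k + s%:E == t%:E then 1 else 0.
  rewrite /f/=; congr (if _ + _ == _ then _ else _).
  by apply: eq_bigr => i _; rewrite tnth_mktuple.
have := next_jump_law madm mK rates mdiag pi_policy Plaw mf (@nnmeasurable1 _ S R).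
have -> : \int[P]_(e in alive k) \int[leb]_(s in `]0%R, +oo[)
    (f (hist k e, s) * (hazard adm q pi k (cst 1) (e, s) *
       survival adm q pi k (e, s))) = 0.
  apply: integral0_eq => e ek.
  pose g s := f (hist k e, s) *
    (hazard adm q pi k (cst 1) (e, s) * survival adm q pi k (e, s)).
  transitivity (\int[leb]_(s in `]0%R, +oo[)
      (g \_ [set (t - fine (jump_time e k))%R]) s).
    apply: eq_integral => s _; rewrite patchE /g; case: ifPn => //; rewrite notin_setE/= => st.
    rewrite fE ifF ?mul0e//.
    apply/eqP => h; apply: st.
    have Tfin := jump_time_fin_num ek.
    move: h; rewrite -(fineK Tfin) -EFinD => -[<-].
    by rewrite addrAC subrr add0r.
  by rewrite -integral_mkcondr (@integral_Sset1 _ _ _ (t - fine (jump_time e k))%R).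
move=> h; apply/eqP; rewrite eq_le measure_ge0 andbT -h.
rewrite -[P N]/(P N) -[N]setIT -integral_indic// integral_mkcond [leRHS]integral_mkcond.
apply: ge0_le_integral => //.
- by move=> e _; rewrite patchE; case: ifP => //; rewrite lee_fin.
- by rewrite patch_setT; exact/measurable_EFinP.
- apply/(measurable_restrictT _ _).1; first exact: measurable_alive.
  apply: measurable_funTS; apply: emeasurable_funM.
    exact: (measurable_hist_sojourn mf).
  exact: (measurable_at_path_state k.+1 (@nnmeasurable1 _ S R)).
move=> e _; rewrite patch_setT indicE.
have [|_] := boolP (e \in N); last first.
  rewrite patchE; case: ifP => // _; apply: mule_ge0; first exact: mf.2.
  by apply: at_state_ge0 => y; exact: lee01.
rewrite inE => Ne.
have ek1 : path_state e k.+1 <> None by apply/jump_time_finP; rewrite Ne ltry.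
have ek := path_stateS ek1.
rewrite patchE mem_set// fE fineK; last first.
  rewrite ge0_fin_numE; last exact/ltW/path_sojourn_gt0.
  exact/path_sojourn_finP.
rewrite -jump_timeS Ne eqxx mul1e.
by case: (path_state e k.+1) ek1 => [y|]//= _; rewrite lexx.
Qed.

(** The policy is carried by the actions admissible in the left limit; it agrees
    with the current state off the null set of paths that jump at [t]. *)
Lemma abse_cost_integral_le (t : R) (v : S -> A -> R) (w : S -> R) (M : R) :
  (0 <= t)%R -> (0 <= M)%R -> measurable_fun setT w -> (forall x, 0 <= w x)%R ->
  (forall y a, adm y a -> `|v y a| <= M * w y)%R ->
  \int[P]_e at_state (xi e t) (fun y =>
       action_integral (pi (e, to_time t)) (fun a => `|v y a|%:E)) <=
  M%:E * \int[P]_e at_state (xi e t) (fun y => (w y)%:E).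
Proof.
move=> t0 M0 mw w0 vM.
have nnw : nnmeasurable (fun y : S => (w y)%:E).
  by split=> [|y]; [exact/measurable_EFinP|rewrite lee_fin].
pose J := \bigcup_k [set e : Om | jump_time e k.+1 = t%:E].
have mJk k := @measurable_jump_at _ S R k.+1 t.
have mJ : measurable J by exact: bigcup_measurable.
have J0 : P (~` ~` J) = 0.
  rewrite setCK; apply/(measure_negligible mJ)/negligible_bigcup => k.
  by exists [set e : Om | jump_time e k.+1 = t%:E]; split=> //; exact: jump_time_no_atom.
have mg : measurable_fun setT (fun e : Om => M%:E * at_state (xi e t) (fun y => (w y)%:E)).
  by apply: emeasurable_funM => //; exact: measurable_at_xi.
have g0 (e : Om) : 0 <= M%:E * at_state (xi e t) (fun y => (w y)%:E).
  by rewrite mule_ge0 ?lee_fin//; apply: at_state_ge0 => y; rewrite lee_fin.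
apply: le_trans (lee_abs _) _.
pose g (e : Om) := M%:E * at_state (xi e t) (fun y => (w y)%:E).
apply: (@le_trans _ _ (\int[P]_(e in ~` J) g e)).
  apply: abse_integral_le_ae (measurableC mJ) J0 _ _ _.
  - exact: measurable_funTS.
  - by move=> e _; exact: g0.
  - move=> e _ nJ; rewrite /g xi_xi_left//; last by move=> k ek; apply: nJ; exists k.
    case ey : (xi_left e t) => [y|]; rewrite /at_state/=; last by rewrite normr0 mule0.
    rewrite -EFinM; apply: (abse_action_integral_le t0 ey).
      by rewrite mulr_ge0.
    by move=> a ya; rewrite /= lee_fin normr_id vM.
rewrite -ge0_integralZl//.
- apply: ge0_subset_integral => //; first exact: measurableC.
  by move=> e _; exact: g0.
- exact: measurable_at_xi.
- by move=> e _; apply: at_state_ge0 => y; rewrite lee_fin.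
Qed.

Variables (alpha rho b M : R) (w : S -> R) (v : S -> A -> R).
Hypothesis alpha_gt0 : (0 < alpha)%R.
Hypothesis rho_ge0 : (0 <= rho)%R.
Hypothesis rho_lt_alpha : (rho < alpha)%R.
Hypothesis b_ge0 : (0 <= b)%R.
Hypothesis M_ge0 : (0 <= M)%R.
Hypothesis mw : measurable_fun setT w.
Hypothesis w_ge0 : forall x, (0 <= w x)%R.
Hypothesis w_drift : forall x a, adm x a ->
  charge_integral (q x a) (fun y => (w y)%:E) <= (rho * w x + b)%:E.
Hypothesis v_bound : forall y a, adm y a -> (`|v y a| <= M * w y)%R.

Local Notation wE := (fun y => (w y)%:E).

(** The time 0, included in the integral of the statement but not in the
    sojourn intervals ]T_k, T_(k+1)], is a null set. *)
Lemma discounted_integral_le :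
  `|\int[leb]_(t in `[0%R, +oo[) ((expR (- alpha * t))%:E *
     \int[P]_e at_state (xi_left e t) (fun y =>
       action_integral (pi (e, to_time t)) (fun a => (v y a)%:E)))| <=
  (M / (alpha * (alpha - rho)))%:E * (alpha%:E * \int[gamma]_x wE x + b%:E).
Proof.
have nnw : nnmeasurable wE.
  by split=> [|y]; [exact/measurable_EFinP|rewrite lee_fin].
have a0 : (alpha != 0)%R by rewrite gt_eqF.
pose I t := \int[P]_e at_state (xi_left e t) wE.
have I0 t : 0 <= I t.
  by apply: integral_ge0 => e _; apply: at_state_ge0 => y; rewrite lee_fin.
have mI : measurable_fun (`]0%R, +oo[%classic : set R) I.
  have := measurable_at_xi_left nnw; set G := (fun z => _) => mG.
  have G0 z : 0 <= G z.
    by rewrite /G; case: ifP => // _; apply: at_state_ge0 => y; rewrite lee_fin.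
  have mFG := @measurable_fun_fubini_tonelli_G _ _ _ _ R P G mG G0.
  apply: (eq_measurable_fun (fubini_G P G)); last exact: measurable_funTS mFG.
  move=> t; rewrite inE/= in_itv/= andbT => t0; apply: eq_integral => e _.
  by rewrite /G/= t0.
have mDI : measurable_fun (`]0%R, +oo[%classic : set R) (fun t => discount_rate alpha t * I t).
  apply: emeasurable_funM => //; apply: measurable_funTS.
  exact: measurable_discount_rate.
have DI0 t : 0 <= discount_rate alpha t * I t by rewrite mule_ge0// discount_rate_ge0.
pose h t := (M / alpha)%:E * (discount_rate alpha t * I t).
have c0 : (0 <= M / alpha)%R by rewrite divr_ge0// ltW.
have mh : measurable_fun (`]0%R, +oo[%classic : set R) h by exact: emeasurable_funM.
have h0 t : 0 <= h t by rewrite mule_ge0.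
have mN : measurable (~` [set 0%R] : set R) by exact: measurableC.
have N0 : leb (~` ~` [set 0%R]) = 0 by rewrite setCK lebesgue_measure_set1.
apply: (@le_trans _ _ (\int[leb]_(t in ~` [set 0%R]) (h \_ `]0%R, +oo[) t)).
  apply: (@abse_integral_le_ae _ _ R leb _ _ _ _ mN N0).
  - apply: measurable_funTS; exact/(measurable_restrictT _ _).1.
  - by move=> t _; apply: erestrict_ge0.
  - move=> t; rewrite /= in_itv/= andbT => t0 /eqP tn0.
    rewrite patchE mem_set; last by rewrite /= in_itv/= andbT lt_neqAle eq_sym tn0.
    rewrite abseM gee0_abs ?lee_fin ?expR_ge0//.
    have -> : h t = (expR (- alpha * t))%:E * (M%:E * I t).
      rewrite /h /discount_rate !muleA -!EFinM; congr (_%:E * _).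
      by rewrite mulrA divfK// mulrC.
    apply: lee_wpmul2l; first by rewrite lee_fin expR_ge0.
    rewrite /I -ge0_integralZl//; last 2 first.
    + have := measurable_at_xi_left nnw => /(measurable_fun_pair1 t).
      by apply: eq_measurable_fun => e _ /=; rewrite lt_neqAle eq_sym tn0 t0.
    + by move=> e _; apply: at_state_ge0 => y; rewrite lee_fin.
    apply: abse_integral_le => e _.
    case ey : (xi_left e t) => [y|]; rewrite /at_state/=; last by rewrite normr0 mule0.
    rewrite -EFinM; apply: (abse_action_integral_le t0 ey) => [|a ya].
      by rewrite mulr_ge0.
    by rewrite /= lee_fin v_bound.
rewrite [X in X <= _](_ : _ = \int[leb]_(t in `]0%R, +oo[) h t); last first.
  rewrite integral_mkcond [RHS]integral_mkcond; apply: eq_integral => t _.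
  rewrite patchE; case: ifPn => //; rewrite notin_setE/= => /contrapT ->.
  by rewrite patchE memNset//= in_itv/= ltxx.
rewrite ge0_integralZl//.
have occ := discounted_occupation madm mK rates mdiag pi_policy Plaw alpha_gt0
  rho_ge0 b_ge0 mw w_ge0 w_drift rho_lt_alpha.
have ar : (0 < alpha - rho)%R by rewrite subr_gt0.
have -> : (M / (alpha * (alpha - rho)) = M / alpha * (alpha - rho)^-1)%R.
  by rewrite invfM mulrA.
rewrite [X in _ <= X * _]EFinM -muleA.
by apply: lee_wpmul2l; rewrite ?lee_fin// lee_pdivlMl.
Qed.

End law_estimates.
End estimates.

Theorem theorem3p3 (R : realType) (S A : completePseudoMetricType R)
  (polishS : polish S) (polishA : polish A)
  (adm : borel S -> set (borel A))
  (adm_borel : forall x, measurable (adm x))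
  (K_borel : measurable (adm_graph adm))
  (q : borel S -> borel A -> {charge set (borel S) -> \bar R})
  (q_rates : transition_rates adm q)
  (N : nat) (r : borel S -> borel A -> R) (c : 'I_N -> borel S -> borel A -> R)
  (r_meas : measurable_fun (adm_graph adm) (fun z => r z.1 z.2))
  (c_meas : forall n, measurable_fun (adm_graph adm) (fun z => c n z.1 z.2))
  (alpha : R) (alpha_gt0 : (0 < alpha)%R)
  (gamma : probability (borel S) R)
  (w : S -> R) (w_cont : continuous w) (w_ge1 : forall x, (1 <= w x)%R)
  (rho b : R) (rho_ge0 : (0 <= rho)%R) (b_ge0 : (0 <= b)%R)
  (Sk : nat -> set S)
  (w_drift : forall x a, adm x a ->
     charge_integral (q x a) (fun y => (w y)%:E) <= (rho * w x + b)%:E)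
  (w_inf_nd : nondecreasing_seq
     (fun k => ereal_inf [set (w x)%:E | x in ~` Sk k]))
  (w_inf_cvg : ereal_inf [set (w x)%:E | x in ~` Sk k] @[k --> \oo] --> +oo)
  (Sk_nd : forall k l, (k <= l)%N -> Sk k `<=` Sk l)
  (Sk_cover : \bigcup_k Sk k = [set: S])
  (Sk_rates : forall k, ereal_sup
     [set y | exists x a, [/\ adm x a, Sk k x & y = `|q x a [set x]|]] < +oo)
  (M : R) (M_gt0 : (0 < M)%R)
  (c_bound : forall (n : 'I_N.+1) x a, adm x a ->
     (`|cost r c n x a| <= M * w x)%R)
  (rho_lt_alpha : (rho < alpha)%R)
  (w_gamma : \int[gamma]_x (w x)%:E < +oo)
  (pi : R.-pker (predictable (borel S) R) ~> (option (borel A)))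
  (pi_policy : policy adm pi)
  (P : borel S -> probability (Omega (borel S) R) R)
  (P_law : forall x, strategic_measure q pi (dirac x) (P x)) :
  (forall (x : borel S) (n : 'I_N.+1) (t : R), (0 <= t)%R ->
     \int[P x]_e at_state (xi e t) (fun y =>
       action_integral (pi (e, to_time t)) (fun a => `|cost r c n y a|%:E)) <=
     M%:E * \int[P x]_e at_state (xi e t) (fun y => (w y)%:E)) /\
  (forall n : 'I_N.+1,
     (forall x : borel S,
        `|discounted_value pi P alpha (cost r c n) x| <=
        (M * (alpha * w x + b) / (alpha * (alpha - rho)))%:E) /\
     `|mean_discounted_value pi P alpha gamma (cost r c n)| <=
     M%:E * ((alpha%:E * \int[gamma]_x (w x)%:E + b%:E) *
             ((alpha * (alpha - rho))^-1)%:E)).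
Proof.
have mdiag := polish_measurable_diagonal polishS.
have mw : measurable_fun setT (w : borel S -> R).
  apply: (measurability _ (RGenOpens.measurableE R)) => _ [_ [a [c' ->]] <-].
  rewrite setTI; apply: sub_sigma_algebra.
  by move/continuousP : w_cont => /(_ _ (interval_open _ _)); apply.
have w0 x : (0 <= w x)%R by exact: le_trans ler01 (w_ge1 x).
have M0 := ltW M_gt0.
have mwE : measurable_fun setT (fun y : borel S => (w y)%:E) by exact/measurable_EFinP.
have V_le n (x : borel S) : `|discounted_value pi P alpha (cost r c n) x| <=
    (M * (alpha * w x + b) / (alpha * (alpha - rho)))%:E.
  apply: le_trans (discounted_integral_le adm_borel K_borel q_rates mdiag
    pi_policy (P_law x) alpha_gt0 rho_ge0 rho_lt_alpha b_ge0 M0 mw w0 w_drift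
    (c_bound n)) _.
  rewrite integral_dirac// diracT mul1e -[X in _ * (X + _)]EFinM -EFinD -EFinM lee_fin.
  by rewrite mulrAC.
split=> [x n t t0|n].
  exact: (abse_cost_integral_le adm_borel K_borel q_rates mdiag pi_policy
    (P_law x) t0 M0 mw w0 (c_bound n)).
split=> [x|]; first exact: V_le.
have ar0 : (0 < alpha * (alpha - rho))%R by rewrite mulr_gt0// subr_gt0.
have k0 : (0 <= M / (alpha * (alpha - rho)))%R by rewrite divr_ge0// ltW.
apply: le_trans (abse_integral_le gamma (fun x _ => V_le n x)) _.
under eq_integral do rewrite mulrAC EFinM EFinD [X in _ * (X + _)]EFinM.
have mawE : measurable_fun setT (fun x : borel S => alpha%:E * (w x)%:E).
  exact: emeasurable_funM.
have aw0 x : 0 <= alpha%:E * (w x)%:E by rewrite mule_ge0 ?lee_fin// ltW.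
rewrite ge0_integralZl//; last 2 first.
- exact: emeasurable_funD.
- by move=> x _; apply: adde_ge0 => //; rewrite lee_fin.
rewrite ge0_integralD//.
rewrite integral_cst// [X in b%:E * X]probability_setT mule1 ge0_integralZl//; last 2 first.
- by move=> x _; rewrite lee_fin.
- by rewrite lee_fin ltW.
by rewrite EFinM -muleA [X in M%:E * X]muleC.
Qed.
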